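(* Let $\mathfrak g$ be a finite-dimensional complex simple Lie algebra and let $\mathcal C$ be the category of finite-dimensional representations of $L(\mathfrak g)=\mathfrak g\otimes\mathbb C[t,t^{-1}]$. (i) Let $\chi\in\Xi$, $U\in\mathcal C_\chi$, and let $\boldsymbol\pi_0\in\mathcal P$ be such that $\chi\neq\chi_{\boldsymbol\pi_0}$. Then $\mathrm{Ext}^1_{L(\mathfrak g)}(U,V(\boldsymbol\pi_0))=0$. (ii) Let $\chi_1,\chi_2\in\Xi$ with $\chi_1\neq\chi_2$ and let $V_j\in\mathcal C_{\chi_j}$, $j=1,2$. Then $\mathrm{Ext}^1_{L(\mathfrak g)}(V_1,V_2)=0$.
   Context: Fix a Cartan subalgebra $\mathfrak h$ of $\mathfrak g$, simple roots $\alpha_i$, fundamental weights $\omega_i$ and simple coroots $h_i$, $i\in I=\{1,\dots,n\}$. $P$ is the weight lattice, $Q$ the root lattice, $P^+$ the set of dominant integral weights, $\Gamma=P/Q$, and $\overline\lambda$ is the image of $\lambda\in P$ in $\Gamma$. For $\lambda\in P^+$, $V(\lambda)$ is the irreducible $\mathfrak g$-module of highest weight $\lambda$. The bracket on $L(\mathfrak g)$ is $[x\otimes f,y\otimes g]=[x,y]\otimes fg$. For $U,V\in\mathcal C$, $\mathrm{Ext}^1_{L(\mathfrak g)}(U,V)=0$ means that every short exact sequence $0\to V\to E\to U\to0$ of $L(\mathfrak g)$-modules splits. Irreducible modules: $\mathcal P$ is the monoid (under coordinatewise multiplication) of $n$-tuples of polynomials in $\mathbb C[u]$ with constant term $1$.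 For $\lambda\in P^+$, $a\in\mathbb C^\times$, $\boldsymbol\pi_{\lambda,a}\in\mathcal P$ has $i$-th coordinate $(1-au)^{\lambda(h_i)}$. Every $\boldsymbol\pi\in\mathcal P$ is uniquely (up to order) a product $\boldsymbol\pi=\prod_{j=1}^r\boldsymbol\pi_{\lambda_j,a_j}$ with distinct $a_j\in\mathbb C^\times$ and nonzero $\lambda_j\in P^+$. $V(\boldsymbol\pi_{\lambda,a})$ is the pull-back of $V(\lambda)$ along the evaluation homomorphism $L(\mathfrak g)\to\mathfrak g$, $x\otimes t^k\mapsto a^kx$, and $V(\boldsymbol\pi)=\bigotimes_{j}V(\boldsymbol\pi_{\lambda_j,a_j})$. The map $\boldsymbol\pi\mapsto V(\boldsymbol\pi)$ is a bijection from $\mathcal P$ to the isomorphism classes of irreducible finite-dimensional $L(\mathfrak g)$-modules. Spectral characters: $\Xi$ is the additive group of functions $\chi:\mathbb C^\times\to\Gamma$ with finite support. $\chi_{\lambda,a}\in\Xi$ takes the value $\overline\lambda$ at $a$ and $0$ elsewhere; for $\boldsymbol\pi=\prod_{j=1}^r\boldsymbol\pi_{\lambda_j,a_j}$ with distinct $a_j\in\mathbb C^\times$ and nonzero $\lambda_j\in P^+$, $\chi_{\boldsymbol\pi}=\sum_j\chi_{\lambda_j,a_j}$. A module $V\in\mathcal C$ has spectral character $\chi$ if $\chi=\chi_{\boldsymbol\pi}$ for every irreducible (Jordan–Hölder) constituent $V(\boldsymbol\pi)$ of $V$; $\mathcal C_\chi$ is the (full) abelian subcategory of all such modules. *)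

(* Defs.v *)
From HB Require Import structures.
From mathcomp Require Import all_boot all_order all_algebra.
From mathcomp Require Import finmap complex ring_quotient.
From mathcomp Require Import boolp classical_sets reals.
From mathcomp.multinomials Require Import monalg.

Set Implicit Arguments.
Unset Strict Implicit.
Unset Printing Implicit Defensive.

Import GRing.Theory Num.Theory.

Local Open Scope classical_set_scope.
Local Open Scope ring_scope.

HB.mixin Record Lmodule_isLieAlgebra (K : fieldType) V of GRing.Lmodule K V := {
  lie : V -> V -> V;
  lie_linearl : forall z a x y, lie (a *: x + y) z = a *: lie x z + lie y z;
  lie_linearr : forall z a x y, lie z (a *: x + y) = a *: lie z x + lie z y;
  lie_alt : forall x, lie x x = 0;
  lie_jacobi : forall x y z,
    lie x (lie y z) + lie y (lie z x) + lie z (lie x y) = 0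
}.

#[short(type="lieAlgType")]
HB.structure Definition LieAlgebra (K : fieldType) :=
  {V of Lmodule_isLieAlgebra K V & GRing.Lmodule K V}.

#[short(type="fdLieAlgType")]
HB.structure Definition FDLieAlgebra (K : fieldType) :=
  {V of LieAlgebra K V & Vector K V}.

Definition simple_lie (K : fieldType) (g : fdLieAlgType K) : Prop :=
  (exists x y : g, lie x y <> 0) /\
  forall I : {vspace g}, (forall x y : g, y \in I -> lie x y \in I) ->
    I = 0%VS \/ I = fullv.

Record lieModule (K : fieldType) (L : lieAlgType K) := LieModule {
  mod_sort :> lmodType K;
  act : L -> mod_sort -> mod_sort;
  act_linearl : forall v a x y, act (a *: x + y) v = a *: act x v + act y v;
  act_linearr : forall x a v w, act x (a *: v + w) = a *: act x v + act x w;
  act_lie : forall x y v, act (lie x y) v = act x (act y v) - act y (act x v)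
}.

Section Modules.
Context (K : fieldType) (L : lieAlgType K).
Implicit Types M N U V E : lieModule L.

Definition finite_dim (V : lmodType K) : Prop :=
  exists (n : nat) (f : {linear 'rV[K]_n -> V}), bijective f.

Definition equivariant M N (f : M -> N) : Prop :=
  forall x v, f (act x v) = act x (f v).

Definition submodule M (S : set M) : Prop :=
  [/\ S 0, forall a v w, S v -> S w -> S (a *: v + w)
    & forall x v, S v -> S (act x v)].

Definition irreducible M : Prop :=
  (exists v : M, v <> 0) /\
  forall S : set M, submodule S -> S = [set 0] \/ S = setT.

(* N is isomorphic to B / A, for submodules A `<=` B of M: the isomorphism is
   given by the projection q of B onto N, whose values outside B are junk. *)
Definition subquotient_iso M (A B : set M) N : Prop :=
  exists q : M -> N,
    [/\ forall a v w, B v -> B w -> q (a *: v + w) = a *: q v + q w,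
        forall x v, B v -> q (act x v) = act x (q v),
        forall y, exists2 v, B v & q v = y
      & forall v, B v -> (q v = 0 <-> A v)].

(* F 0 = 0, F k = M, each F i is a maximal proper submodule of F i.+1. *)
Definition composition_series M (k : nat) (F : nat -> set M) : Prop :=
  [/\ forall i, (i <= k)%N -> submodule (F i), F 0%N = [set 0], F k = setT
    & forall i, (i < k)%N ->
        [/\ F i `<=` F i.+1, F i <> F i.+1
          & forall S, submodule S -> F i `<=` S -> S `<=` F i.+1 ->
              S = F i \/ S = F i.+1]].

Definition constituent M N : Prop :=
  exists (k : nat) (F : nat -> set M) (i : nat),
    [/\ composition_series k F, (i < k)%N & subquotient_iso (F i) (F i.+1) N].

Definition Ext1_zero U V : Prop :=
  forall (E : lieModule L) (i : {linear V -> E}) (p : {linear E -> U}),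
    equivariant i -> equivariant p ->
    injective i -> (forall u, exists e, p e = u) ->
    (forall e, p e = 0 <-> exists v, i v = e) ->
    exists s : {linear U -> E}, equivariant s /\ forall u, p (s u) = u.

Definition bilinear_map (U V W : lmodType K) (b : U -> V -> W) : Prop :=
  (forall v a u u', b (a *: u + u') v = a *: b u v + b u' v) /\
  (forall u a v v', b u (a *: v + v') = a *: b u v + b u v').

Definition tensor_product (U V T : lmodType K) (tau : U -> V -> T) : Prop :=
  bilinear_map tau /\
  forall (W : lmodType K) (b : U -> V -> W), bilinear_map b ->
    exists f : {linear T -> W}, (forall u v, f (tau u v) = b u v) /\
      forall f' : {linear T -> W}, (forall u v, f' (tau u v) = b u v) -> f' =1 f.

Definition tensor_module M N (T : lieModule L) : Prop :=
  exists tau : M -> N -> T, tensor_product tau /\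
    forall x u v, act x (tau u v) = tau (act x u) v + tau u (act x v).

Definition trivial_module M : Prop :=
  (exists e : M, e <> 0 /\ forall v : M, exists c : K, v = c *: e) /\
  forall (x : L) (v : M), act x v = 0.

End Modules.

Section MalgLinear.
Context (K : fieldType) (I : choiceType) (V : lmodType K).

Definition malgv : Type := {malg V[I]}.
HB.instance Definition _ := GRing.Zmodule.on malgv.

Definition malgv_scale (a : K) (f : malgv) : malgv :=
  [malg k in msupp f => a *: f@_k].

Lemma malgv_scaleE a f k : (malgv_scale a f)@_k = a *: f@_k.
Proof. by rewrite mcoeffE; case: msuppP; rewrite ?scaler0. Qed.

Fact malgv_scaleA a b f :
  malgv_scale a (malgv_scale b f) = malgv_scale (a * b) f.
Proof. by apply/malgP => k; rewrite !malgv_scaleE scalerA. Qed.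

Fact malgv_scale1 : left_id 1 malgv_scale.
Proof. by move=> f; apply/malgP => k; rewrite malgv_scaleE scale1r. Qed.

Fact malgv_scaleDr : right_distributive malgv_scale +%R.
Proof.
by move=> a f h; apply/malgP => k; rewrite mcoeffD !malgv_scaleE mcoeffD scalerDr.
Qed.

Fact malgv_scaleDl f : {morph malgv_scale^~ f : a b / a + b}.
Proof.
by move=> a b; apply/malgP => k; rewrite mcoeffD !malgv_scaleE scalerDl.
Qed.

HB.instance Definition _ := GRing.Zmodule_isLmodule.Build K malgv
  malgv_scaleA malgv_scale1 malgv_scaleDr malgv_scaleDl.

Definition mono (k : I) (x : V) : malgv := << x *g k >>.

Lemma mcoeffZv a (f : malgv) k : (a *: f)@_k = a *: f@_k.
Proof. exact: malgv_scaleE. Qed.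

Lemma mono_linear k a x y : mono k (a *: x + y) = a *: mono k x + mono k y.
Proof.
apply/malgP => j; rewrite mcoeffD mcoeffZv !mcoeffU.
by rewrite mulrnDl scalerMnr.
Qed.

Definition malgv_ext (W : lmodType K) (phi : I -> V -> W) (f : malgv) : W :=
  \sum_(k <- msupp f) phi k f@_k.

Section Ext.
Context (W : lmodType K) (phi : I -> V -> W).
Hypothesis phiL : forall k a x y, phi k (a *: x + y) = a *: phi k x + phi k y.

Let phi0 k : phi k 0 = 0.
Proof. by have := phiL k (-1) 0 0; rewrite scaler0 addr0 scaleN1r addNr. Qed.

Lemma malgv_extw (d : {fset I}) f : (msupp f `<=` d)%fset ->
  malgv_ext phi f = \sum_(k <- d) phi k f@_k.
Proof.
move=> sfd; rewrite /malgv_ext (big_fset_incl _ sfd) // => k _.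
by move=> /mcoeff_outdom ->.
Qed.

Lemma malgv_ext_linear a f h :
  malgv_ext phi (a *: f + h) = a *: malgv_ext phi f + malgv_ext phi h.
Proof.
pose d := (msupp f `|` msupp h `|` msupp (a *: f + h))%fset.
rewrite !(@malgv_extw d); try by apply/fsubsetP => k; rewrite !inE => ->;
  rewrite ?orbT.
rewrite scaler_sumr -big_split /=; apply: eq_bigr => k _.
by rewrite mcoeffD mcoeffZv phiL.
Qed.

Lemma malgv_ext_mono k x : malgv_ext phi (mono k x) = phi k x.
Proof.
rewrite (@malgv_extw [fset k]%fset) ?big_seq_fset1 ?mcoeffUU //.
apply/fsubsetP => j; rewrite -mcoeff_neq0 mcoeffU in_fset1.
by have [_|] := eqVneq k j; rewrite ?mulr0n ?eqxx.
Qed.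
End Ext.

Lemma malgv_ind (P : malgv -> Prop) :
  P 0 -> (forall f h, P f -> P h -> P (f + h)) -> (forall k x, P (mono k x)) ->
  forall f, P f.
Proof.
move=> P0 PD PM f; rewrite [f]monalgE.
by elim/big_rec: _ => // k h _ Ph; apply: PD.
Qed.

End MalgLinear.

Section Biadditive.
Context (W : zmodType) (B : W -> W -> W) (G : W -> Prop).
Hypothesis indG : forall P : W -> Prop, P 0 ->
  (forall u v, P u -> P v -> P (u + v)) -> (forall u, G u -> P u) ->
  forall u, P u.
Hypothesis BDr : forall w u v, B w (u + v) = B w u + B w v.
Hypothesis BDl : forall w u v, B (u + v) w = B u w + B v w.

Let B0r w : B w 0 = 0.
Proof. by apply: (addrI (B w 0)); rewrite -BDr !addr0. Qed.
Let B0l w : B 0 w = 0.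
Proof. by apply: (addrI (B 0 w)); rewrite -BDl !addr0. Qed.

Lemma biadd_alt : (forall u v, G u -> G v -> B u v + B v u = 0) ->
  (forall u, G u -> B u u = 0) -> forall u, B u u = 0.
Proof.
move=> GC GA.
have BC u v : B u v + B v u = 0.
  elim/indG: u v => [v|u u' Hu Hu' v|u Gu]; first by rewrite B0r B0l addr0.
    by rewrite BDl BDr addrACA Hu Hu' addr0.
  elim/indG => [|v v' Hv Hv'|v Gv]; first by rewrite B0r B0l addr0.
    by rewrite BDl BDr addrACA Hv Hv' addr0.
  exact: GC.
elim/indG => [|u v Hu Hv|u Gu]; [exact: B0r | | exact: GA].
by rewrite BDr !BDl Hu Hv add0r addr0 addrC BC.
Qed.

Let sum6 (u u' v v' w w' : W) :
  u + u' + (v + v') + (w + w') = (u + v + w) + (u' + v' + w').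
Proof. by rewrite (addrACA u) (addrACA (u + v)). Qed.

Lemma biadd_jacobi :
  (forall u v w, G u -> G v -> G w ->
     B u (B v w) + B v (B w u) + B w (B u v) = 0) ->
  forall u v w, B u (B v w) + B v (B w u) + B w (B u v) = 0.
Proof.
move=> GJ u v w; elim/indG: u v w => [v w|u u' Hu Hu' v w|u Gu].
- by rewrite !(B0r, B0l) !addr0.
- by rewrite !(BDr, BDl) sum6 Hu Hu' addr0.
elim/indG => [w|v v' Hv Hv' w|v Gv].
- by rewrite !(B0r, B0l) !addr0.
- by rewrite !(BDr, BDl) sum6 Hv Hv' addr0.
elim/indG => [|w w' Hw Hw'|w Gw].
- by rewrite !(B0r, B0l) !addr0.
- by rewrite !(BDr, BDl) sum6 Hw Hw' addr0.
exact: GJ.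
Qed.
End Biadditive.

(* The loop algebra: g \otimes K[t, t^-1] is the space of finitely supported
   functions int -> g, the function f standing for \sum_k f@_k \otimes t^k, so
   that loop_mono k x = << x *g k >> is x \otimes t^k. *)

Section Loop.
Context (K : fieldType) (g : lieAlgType K).

Definition loop : Type := malgv int g.
HB.instance Definition _ := GRing.Lmodule.on loop.

Definition loop_mono (k : int) (x : g) : loop := mono k x.

Lemma loop_ind (P : loop -> Prop) :
  P 0 -> (forall f h, P f -> P h -> P (f + h)) ->
  (forall k x, P (loop_mono k x)) -> forall f, P f.
Proof. exact: malgv_ind. Qed.

Definition loop_lie (f h : loop) : loop :=
  \sum_(j <- msupp f) \sum_(k <- msupp h) loop_mono (j + k) (lie f@_j h@_k).

Let brr (j : int) (x : g) : loop -> loop :=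
  malgv_ext (fun k y => loop_mono (j + k) (lie x y)).

Let brrL j x a f h : brr j x (a *: f + h) = a *: brr j x f + brr j x h.
Proof.
apply: malgv_ext_linear => k b y z.
by rewrite lie_linearr [LHS]mono_linear.
Qed.

Let brrLl h j a x y : brr j (a *: x + y) h = a *: brr j x h + brr j y h.
Proof.
rewrite /brr /malgv_ext scaler_sumr -big_split /=; apply: eq_bigr => k _.
by rewrite lie_linearl [LHS]mono_linear.
Qed.

Let loop_lieE f h : loop_lie f h = malgv_ext (fun j x => brr j x h) f.
Proof. by []. Qed.

Lemma loop_lie_mono j k x y :
  loop_lie (loop_mono j x) (loop_mono k y) = loop_mono (j + k) (lie x y).
Proof.
rewrite loop_lieE malgv_ext_mono; last exact: brrLl.
by rewrite /brr malgv_ext_mono // => i a u v; rewrite lie_linearr [LHS]mono_linear.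
Qed.

Fact loop_lie_linearl h a e f :
  loop_lie (a *: e + f) h = a *: loop_lie e h + loop_lie f h.
Proof. by rewrite !loop_lieE; apply: malgv_ext_linear; apply: brrLl. Qed.

Fact loop_lie_linearr h a e f :
  loop_lie h (a *: e + f) = a *: loop_lie h e + loop_lie h f.
Proof.
rewrite !loop_lieE /malgv_ext scaler_sumr -big_split /=.
by apply: eq_bigr => k _; rewrite brrL.
Qed.

Let llD h e f : loop_lie h (e + f) = loop_lie h e + loop_lie h f.
Proof. by have := loop_lie_linearr h 1 e f; rewrite !scale1r. Qed.
Let llDl h e f : loop_lie (e + f) h = loop_lie e h + loop_lie f h.
Proof. by have := loop_lie_linearl h 1 e f; rewrite !scale1r. Qed.
Let ll0 h : loop_lie h 0 = 0.
Proof. by apply: (addrI (loop_lie h 0)); rewrite -llD !addr0. Qed.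
Let ll0l h : loop_lie 0 h = 0.
Proof. by apply: (addrI (loop_lie 0 h)); rewrite -llDl !addr0. Qed.

Let lieD (x y z : g) : lie x (y + z) = lie x y + lie x z.
Proof. by have := lie_linearr x 1 y z; rewrite !scale1r. Qed.
Let lieDl (x y z : g) : lie (y + z) x = lie y x + lie z x.
Proof. by have := lie_linearl x 1 y z; rewrite !scale1r. Qed.
Let lieC (x y : g) : lie x y + lie y x = 0.
Proof.
by have := lie_alt (x + y); rewrite lieD !lieDl !lie_alt add0r addr0 addrC.
Qed.

Let monoD k x y : loop_mono k (x + y) = loop_mono k x + loop_mono k y.
Proof. by have := mono_linear k 1 x y; rewrite !scale1r. Qed.
Let mono0 k : loop_mono k 0 = 0.
Proof. by apply: (addrI (loop_mono k 0)); rewrite -monoD !addr0. Qed.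

Let is_mono (f : loop) := exists k x, f = loop_mono k x.
Let is_mono_ind (P : loop -> Prop) :
  P 0 -> (forall f h, P f -> P h -> P (f + h)) ->
  (forall f, is_mono f -> P f) -> forall f, P f.
Proof.
by move=> P0 PD PM; apply: loop_ind => // k x; apply: PM; exists k, x.
Qed.

Fact loop_lie_alt f : loop_lie f f = 0.
Proof.
apply: (biadd_alt is_mono_ind llD llDl) => [_ _ [j [x ->]] [k [y ->]]|_ [k [x ->]]].
  by rewrite !loop_lie_mono [(k + j)%R]addrC -monoD lieC mono0.
by rewrite loop_lie_mono lie_alt mono0.
Qed.

Fact loop_lie_jacobi e f h :
  loop_lie e (loop_lie f h) + loop_lie f (loop_lie h e)
    + loop_lie h (loop_lie e f) = 0.
Proof.
apply: (biadd_jacobi is_mono_ind llD llDl).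
move=> _ _ _ [i [x ->]] [j [y ->]] [k [z ->]]; rewrite !loop_lie_mono.
rewrite [(j + (k + i))%R]addrA [(j + k + i)%R]addrC.
by rewrite [(k + (i + j))%R]addrC -[(i + j + k)%R]addrA -!monoD lie_jacobi mono0.
Qed.

HB.instance Definition _ := Lmodule_isLieAlgebra.Build K loop
  loop_lie_linearl loop_lie_linearr loop_lie_alt loop_lie_jacobi.

End Loop.

Definition nonzero (K : fieldType) : Type := {a : K | a != 0}.
HB.instance Definition _ (K : fieldType) := Choice.on (nonzero K).

Section Evaluation.
Context (K : fieldType) (g : lieAlgType K) (a : nonzero K).

Definition ev (f : loop g) : g := \sum_(k <- msupp f) (val a ^ k) *: f@_k.

Let evE f : ev f = malgv_ext (fun k x => (val a ^ k) *: x) f.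
Proof. by []. Qed.

Let evL k b (x y : g) :
  (val a ^ k) *: (b *: x + y) = b *: ((val a ^ k) *: x) + (val a ^ k) *: y.
Proof. by rewrite scalerDr !scalerA mulrC. Qed.

Lemma ev_mono k x : ev (loop_mono k x) = (val a ^ k) *: x.
Proof. by rewrite evE malgv_ext_mono. Qed.

Lemma ev_linear b e f : ev (b *: e + f) = b *: ev e + ev f.
Proof. by rewrite !evE malgv_ext_linear. Qed.

Lemma ev_lie e f : ev (lie e f) = lie (ev e) (ev f).
Proof.
have evD e1 e2 : ev (e1 + e2) = ev e1 + ev e2.
  by have := ev_linear 1 e1 e2; rewrite !scale1r.
have ev0 : ev 0 = 0 by apply: (addrI (ev 0)); rewrite -evD !addr0.
have lD (L : lieAlgType K) (z x y : L) : lie z (x + y) = lie z x + lie z y.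
  by have := lie_linearr z 1 x y; rewrite !scale1r.
have lDl (L : lieAlgType K) (z x y : L) : lie (x + y) z = lie x z + lie y z.
  by have := lie_linearl z 1 x y; rewrite !scale1r.
have l0 (L : lieAlgType K) (z : L) : lie z 0 = 0.
  by apply: (addrI (lie z 0)); rewrite -lD !addr0.
have l0l (L : lieAlgType K) (z : L) : lie 0 z = 0.
  by apply: (addrI (lie 0 z)); rewrite -lDl !addr0.
have lZ (z x : g) c : lie z (c *: x) = c *: lie z x.
  by have := lie_linearr z c x 0; rewrite !addr0 l0 addr0.
have lZl (z x : g) c : lie (c *: x) z = c *: lie x z.
  by have := lie_linearl z c x 0; rewrite !addr0 l0l addr0.
elim/loop_ind: e => [|e e' He He'|j x]; first by rewrite l0l ev0 l0l.
  by rewrite lDl !evD lDl He He'.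
elim/loop_ind: f => [|f f' Hf Hf'|k y]; first by rewrite l0 ev0 l0.
  by rewrite lD !evD lD Hf Hf'.
have -> : lie (loop_mono j x) (loop_mono k y) = loop_mono (j + k) (lie x y).
  exact: loop_lie_mono.
rewrite !ev_mono.
by rewrite lZ lZl scalerA expfzDr ?(valP a) // mulrC.
Qed.

Context (V : lieModule g).

Fact ev_act_linearl (v : V) b e f :
  act (ev (b *: e + f)) v = b *: act (ev e) v + act (ev f) v.
Proof. by rewrite ev_linear act_linearl. Qed.

Fact ev_act_lie e f (v : V) : act (ev (lie e f)) v =
  act (ev e) (act (ev f) v) - act (ev f) (act (ev e) v).
Proof. by rewrite ev_lie act_lie. Qed.

Definition ev_module : lieModule (loop g) :=
  @LieModule K (loop g) V (fun f v => act (ev f) v)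
    ev_act_linearl (fun f => act_linearr (ev f)) ev_act_lie.

End Evaluation.

Section Roots.
Context (K : fieldType) (g : fdLieAlgType K).

Definition ad_diagonalizable (x : g) : Prop :=
  exists X : seq g, basis_of fullv X /\
    forall v, v \in X -> exists c : K, lie x v = c *: v.

Definition toral (h : {vspace g}) : Prop :=
  (forall x y, x \in h -> y \in h -> lie x y = 0) /\
  (forall x, x \in h -> ad_diagonalizable x).

(* Cartan subalgebras of a semisimple Lie algebra: the maximal abelian
   subalgebras consisting of ad-diagonalizable elements. *)
Definition cartan_subalgebra (h : {vspace g}) : Prop :=
  toral h /\ forall h' : {vspace g}, toral h' -> (h <= h')%VS -> h' = h.

Definition dual (h : {vspace g}) : Type := 'Hom(subvs_of h, K^o).
HB.instance Definition _ (h : {vspace g}) := Vector.on (dual h).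

Context (h : {vspace g}).

Definition dual_app (lambda : dual h) (x : subvs_of h) : K :=
  (lambda : 'Hom(subvs_of h, K^o)) x.

Definition root_space (beta : dual h) (y : g) : Prop :=
  forall x : subvs_of h, lie (vsval x) y = dual_app beta x *: y.

Definition is_root (beta : dual h) : Prop :=
  beta <> 0 /\ exists y, y <> 0 /\ root_space beta y.

Definition nonneg_comb n (alpha : 'I_n -> dual h) (beta : dual h) : Prop :=
  exists c : 'I_n -> nat, beta = \sum_i alpha i *+ c i.

Definition simple_system n (alpha : 'I_n -> dual h) : Prop :=
  [/\ forall i, is_root (alpha i),
      basis_of fullv (codom alpha)
    & forall beta, is_root beta ->
        nonneg_comb alpha beta \/ nonneg_comb alpha (- beta)].

End Roots.

Record cartanDatum (K : fieldType) (g : fdLieAlgType K) := CartanDatum {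
  csa : {vspace g};
  csaP : cartan_subalgebra csa;
  rk : nat;
  sroot : 'I_rk -> dual csa;
  srootP : simple_system sroot;
  coroot : 'I_rk -> subvs_of csa;
  corootP : forall i, exists x y,
    [/\ root_space (sroot i) x, root_space (- sroot i) y
      & vsval (coroot i) = lie x y];
  coroot2 : forall i, dual_app (sroot i) (coroot i) = 2;
  fweight : 'I_rk -> dual csa;
  fweightP : forall i j, dual_app (fweight i) (coroot j) = (i == j)%:R
}.

Section Weights.
Context (K : closedFieldType) (g : fdLieAlgType K) (D : cartanDatum g).

(* An element lambda of the weight lattice P is stored by its coordinates on
   the fundamental weights, i.e. lambda i = lambda(h_i); wt lambda is lambda
   as a linear form on the Cartan subalgebra. *)
Definition weight : Type := {ffun 'I_(rk D) -> int}.
HB.instance Definition _ := GRing.Zmodule.on weight.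

Definition wt (lambda : weight) : dual (csa D) :=
  \sum_i fweight i *~ (lambda : {ffun _ -> _}) i.

(* The dominant weights P^+: here lambda(h_i) is a natural number. *)
Definition domWeight : Type := {ffun 'I_(rk D) -> nat}.
HB.instance Definition _ := Choice.on domWeight.

Definition dom_app (lambda : domWeight) (i : 'I_(rk D)) : nat :=
  (lambda : {ffun _ -> _}) i.

Definition weight_of_dom (lambda : domWeight) : weight :=
  [ffun i => Posz (dom_app lambda i)].

(* Q, as a subgroup of P *)
Definition root_lattice : pred weight :=
  fun lambda => `[< exists c : 'I_(rk D) -> int, wt lambda = \sum_i sroot i *~ c i >].

Lemma wtB lambda mu : wt (lambda - mu) = wt lambda - wt mu.
Proof.
rewrite /wt -sumrB; apply: eq_bigr => i _.
by rewrite !ffunE mulrzBr.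
Qed.

Fact root_lattice_zmod : zmod_closed root_lattice.
Proof.
split.
  apply/asboolP; exists (fun=> 0).
  by rewrite /wt !big1 // => i _; rewrite ?ffunE mulr0z.
move=> lambda mu /asboolP[c cE] /asboolP[d dE]; apply/asboolP.
exists (fun i => c i - d i); rewrite wtB cE dE -sumrB.
by apply: eq_bigr => i _; rewrite mulrzBr.
Qed.
HB.instance Definition _ :=
  GRing.isZmodClosed.Build weight root_lattice root_lattice_zmod.

(* Gamma = P / Q *)
Definition Gamma : Type := Quotient.quot (GRing.ZmodClosed.clone weight root_lattice _).
HB.instance Definition _ := GRing.Zmodule.on Gamma.
HB.instance Definition _ := Quotient.on Gamma.

Definition class_of (lambda : domWeight) : Gamma :=
  \pi_Gamma%qT (weight_of_dom lambda).

(* M is V(lambda): irreducible, with a nonzero vector v such that n^+ v = 0 and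
   x v = lambda(x) v for x in the Cartan subalgebra. *)
Definition is_V (lambda : domWeight) (M : lieModule g) : Prop :=
  irreducible M /\
  exists v : M,
    [/\ v <> 0,
        forall beta y, is_root beta -> nonneg_comb (@sroot _ _ D) beta ->
          root_space beta y -> act y v = 0
      & forall x : subvs_of (csa D),
          act (vsval x) v = dual_app (wt (weight_of_dom lambda)) x *: v].

Definition drinfeld : Type :=
  {q : {ffun 'I_(rk D) -> {poly K}} | [forall i, (q i)`_0 == 1]}.

Definition drinfeld_coord (pi : drinfeld) (i : 'I_(rk D)) : {poly K} := val pi i.

(* s lists pairs (lambda_j, a_j) such that pi is the product of the
   pi_(lambda_j, a_j), with distinct a_j and nonzero lambda_j. *)
Definition is_factorization (pi : drinfeld) (s : seq (domWeight * nonzero K)) :=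
  [&& uniq [seq x.2 | x <- s],
      all (fun x => weight_of_dom x.1 != 0) s
    & [forall i, drinfeld_coord pi i ==
        \prod_(x <- s) (1 - val x.2 *: 'X) ^+ dom_app x.1 i]].

Lemma poly_factor (p : {poly K}) : p`_0 = 1 ->
  exists r : seq (nonzero K), p = \prod_(a <- r) (1 - val a *: 'X).
Proof.
move=> p0; have [r pE] := closed_field_poly_normal p.
have pN0 : p != 0 by apply/eqP => p0'; move: p0; rewrite p0' coef0 => /esym/eqP;
  rewrite oner_eq0.
have r0 z : z \in r -> z != 0.
  move=> zr; apply/eqP => z0; move: p0; rewrite -horner_coef0 pE hornerZ.
  rewrite -z0 horner_prod (big_rem z) //= hornerXsubC subrr mul0r mulr0.
  by by move/esym/eqP; rewrite oner_eq0.
have {r0} [r' rE] : exists r' : seq (nonzero K), r = [seq (val a)^-1 | a <- r'].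
  elim: r r0 {pE} => [|z r IH] r0; first by exists [::].
  have [|r' ->] := IH; first by move=> y yr; apply: r0; rewrite inE yr orbT.
  have z0 : z^-1 != 0 by rewrite invr_eq0 r0 // mem_head.
  by exists (exist _ z^-1 z0 :: r'); rewrite /= invrK.
exists r'.
have XE a : a \in r' ->
    'X - ((val a)^-1)%:P = (- (val a)^-1) *: (1 - val a *: 'X).
  rewrite scalerBr scalerA mulNr mulVf ?(valP a) // scaleN1r opprK addrC.
  by rewrite alg_polyC polyCN.
rewrite [LHS]pE rE big_map big_seq (eq_bigr _ XE) -big_seq scaler_prod scalerA.
set c := (X in X *: _); suff -> : c = 1 by rewrite scale1r.
have := p0; rewrite -horner_coef0 pE rE big_map big_seq (eq_bigr _ XE) -big_seq.
rewrite scaler_prod scalerA hornerZ -/c horner_prod big1 ?mulr1 // => a _.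
by rewrite !hornerE ?mulr0 ?subr0.
Qed.

Lemma factorization_exists (pi : drinfeld) : exists s, is_factorization pi s.
Proof.
have /fin_all_exists[r rE] : forall i, exists r : seq (nonzero K),
    drinfeld_coord pi i = \prod_(a <- r) (1 - val a *: 'X).
  by move=> i; apply: poly_factor; apply/eqP; apply: (forallP (valP pi)).
pose A := undup (flatten [seq r i | i <- enum 'I_(rk D)]).
pose lam a : domWeight := [ffun i => count_mem a (r i)].
exists [seq (lam a, a) | a <- A]; apply/and3P; split.
- by rewrite -map_comp map_id undup_uniq.
- apply/allP => _ /mapP[a + ->] /=; rewrite mem_undup => /flatten_mapP[i _ ari].
  apply/eqP => /ffunP/(_ i); rewrite !ffunE /dom_app ffunE => /eqP.
  by rewrite eqz_nat -leqn0 leqNgt -has_count has_pred1 ari.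
- apply/forallP => i; rewrite rE big_map /=; apply/eqP.
  rewrite -[LHS]prodr_undup_exp_count.
  rewrite [RHS](bigID (fun a => a \in r i)) /= [X in _ * X]big1 ?mulr1.
    rewrite -[RHS]big_filter; under [RHS]eq_bigr do rewrite /dom_app ffunE.
    apply: perm_big. apply: uniq_perm; rewrite ?filter_uniq ?undup_uniq // => a.
    rewrite mem_filter !mem_undup; case ari : (a \in r i) => //=.
    by apply/esym/flatten_mapP; exists i; rewrite ?mem_enum.
  move=> a /negPf ari; rewrite /dom_app ffunE.
  by move: ari; rewrite -has_pred1 has_count lt0n => /negbFE/eqP ->.
Qed.

Lemma mup_factor (a b : nonzero K) n :
  mup (val a)^-1 ((1 - val b *: 'X) ^+ n) = ((b == a) * n)%N.
Proof.
have -> : 1 - val b *: 'X = (- val b)%:P * ('X - ((val b)^-1)%:P).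
  rewrite mulrBr -polyCM mulNr mulfV ?(valP b) // !polyCN opprK.
  by rewrite mulNr mul_polyC addrC.
rewrite exprMn mupMr; last first.
  by rewrite -polyC_exp rootC expf_neq0 // oppr_eq0 (valP b).
rewrite mup_XsubCX (inj_eq invr_inj) -val_eqE.
by case: eqP; rewrite ?mul1n ?mul0n.
Qed.

Lemma factorization_mup pi s a i : is_factorization pi s ->
  mup (val a)^-1 (drinfeld_coord pi i) =
  (\sum_(x <- s) (x.2 == a) * dom_app x.1 i)%N.
Proof.
case/and3P=> _ _ /forallP/(_ i)/eqP ->.
have f0 (x : domWeight * nonzero K) : (1 - val x.2 *: 'X) ^+ dom_app x.1 i != 0.
  rewrite expf_neq0 //; apply/eqP => /(congr1 (fun q : {poly K} => q.[0])) /eqP.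
  by rewrite !hornerE ?mulr0 ?subr0 oner_eq0.
elim: s => [|x s IH]; last first.
  rewrite !big_cons mupM ?mup_factor ?IH //.
  by rewrite prodf_seq_neq0; apply/allP => x' _; apply: f0.
by rewrite !big_nil mupNroot // root1.
Qed.

Lemma mem_factorization pi s lambda a : is_factorization pi s ->
  (lambda, a) \in s =
  (weight_of_dom lambda != 0) &&
    [forall i, dom_app lambda i == mup (val a)^-1 (drinfeld_coord pi i)].
Proof.
move=> Fs; have /and3P[us /allP s0 _] := Fs.
have mupE mu i : (mu, a) \in s ->
    mup (val a)^-1 (drinfeld_coord pi i) = dom_app mu i.
  move=> mus; rewrite (factorization_mup a i Fs) (big_rem (mu, a)) //= eqxx mul1n.
  rewrite big_seq big1 ?addn0 // => y ys; case: eqP => // ya.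
  have := us; rewrite (perm_uniq (perm_map snd (perm_to_rem mus))) /=.
  by have := map_f snd ys; rewrite /= ya => ->.
apply/idP/andP => [las|[l0 /forallP lE]].
  by split; [exact: (s0 _ las) | apply/forallP => i; rewrite (mupE lambda)].
have [mu mus] : exists mu, (mu, a) \in s.
  have [i li] : exists i, dom_app lambda i != 0%N.
    apply/existsP; apply: contraR l0; rewrite negb_exists => /forallP l0.
    by apply/eqP/ffunP => i; rewrite !ffunE; have /negPn/eqP -> := l0 i.
  have [/hasP[[mu b] /= mus /eqP ab]|/hasPn nos] :=
    boolP (has (fun x => x.2 == a) s); first by exists mu; rewrite -ab.
  case/eqP: li; rewrite (eqP (lE i)) (factorization_mup a i Fs) big_seq big1 // => y.
  by move/nos/negPf ->.
suff -> : lambda = mu by [].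
by apply/ffunP => i; have := eqP (lE i); rewrite (mupE mu).
Qed.

Lemma factorization_unique pi s s' :
  is_factorization pi s -> is_factorization pi s' -> perm_eq s s'.
Proof.
move=> Fs Fs'; have /and3P[us _ _] := Fs; have /and3P[us' _ _] := Fs'.
apply: uniq_perm; rewrite ?(map_uniq us) ?(map_uniq us') // => -[lambda a].
by rewrite (mem_factorization _ _ Fs) (mem_factorization _ _ Fs').
Qed.

Definition factorization (pi : drinfeld) : seq (domWeight * nonzero K) :=
  xchoose (factorization_exists pi).

Lemma factorizationP pi : is_factorization pi (factorization pi).
Proof. exact: xchooseP. Qed.

(* T is isomorphic to the tensor product of the V(pi_(lambda_j, a_j)). The
   modules V(lambda) and V(pi), which are defined up to isomorphism, are
   rendered by the predicates is_V lambda and is_Vpi pi on modules. *)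
Fixpoint is_tensor_of_ev (s : seq (domWeight * nonzero K))
    (T : lieModule (loop g)) : Prop :=
  if s is (lambda, a) :: s' then
    exists (V : lieModule g) (T' : lieModule (loop g)),
      [/\ is_V lambda V, is_tensor_of_ev s' T' & tensor_module (ev_module a V) T' T]
  else trivial_module T.

Definition is_Vpi (pi : drinfeld) (T : lieModule (loop g)) : Prop :=
  is_tensor_of_ev (factorization pi) T.

(* Xi: finitely supported functions from K^* to Gamma *)
Definition Xi : Type := {malg Gamma[nonzero K]}.
HB.instance Definition _ := GRing.Zmodule.on Xi.

Definition chi_ev (lambda : domWeight) (a : nonzero K) : Xi :=
  << class_of lambda *g a >>.

Definition chi_of (pi : drinfeld) : Xi :=
  \sum_(x <- factorization pi) chi_ev x.1 x.2.

(* By the classification of the finite-dimensional irreducible modules, a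
   constituent N of a finite-dimensional V is V(pi) for exactly one pi. *)
Definition has_spectral_character (chi : Xi) (V : lieModule (loop g)) : Prop :=
  forall N : lieModule (loop g), constituent V N ->
    exists2 pi : drinfeld, is_Vpi pi N & chi = chi_of pi.

Definition in_Cchi (chi : Xi) (V : lieModule (loop g)) : Prop :=
  finite_dim V /\ has_spectral_character chi V.

End Weights.

(* Main.v *)
(* Suppose the two spectral characters differ at a, and let w be a fundamental
   coweight separating their values at a modulo the root lattice: elements of P
   take values on w in C, elements of Q take values in Z.  An extension E of the
   two modules is killed by g \otimes I for some ideal I of finite codimension in
   C[t, t^-1]; let e be the idempotent of C[t, t^-1] / I supported at a.  On every
   irreducible constituent the eigenvalues of w \otimes e lie in the coset of Z
   given by the spectral character at a, while L(g) / (g \otimes I) is spanned by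
   eigenvectors of ad (w \otimes e) with integer eigenvalues.  So grouping the
   generalized eigenspaces of w \otimes e on E by cosets of Z decomposes E into
   L(g)-submodules, which splits the extension. *)

Require Import Defs.
From HB Require Import structures.
From mathcomp Require Import all_boot all_order all_algebra.
From mathcomp Require Import complex reals.
From mathcomp Require Import finmap ring_quotient boolp classical_sets.
From mathcomp.multinomials Require Import monalg.

Set Implicit Arguments.
Unset Strict Implicit.
Unset Printing Implicit Defensive.

Import GRing.Theory Num.Theory.

Local Open Scope classical_set_scope.
Local Open Scope ring_scope.

(** * Generalized eigenvectors of a linear operator *)

Section GeneralizedEigenvectors.
Context (K : fieldType).
Implicit Types (E : lmodType K) (C : K -> Prop) (s : seq K).

(** This is $\prod_{r\in s}(H-r)$ applied to [v]: a list with repetitions encodes a split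
    polynomial, and concatenation is multiplication. *)
Fixpoint shifts E (H : E -> E) s (v : E) : E :=
  if s is r :: s' then shifts H s' (H v - r *: v) else v.

(* Over an algebraically closed field, and when H is locally finite, this is the
   sum of the generalized eigenspaces of H for the eigenvalues in C. *)
Definition gen_eig E (H : E -> E) C (v : E) : Prop :=
  exists2 s, (forall r, r \in s -> C r) & shifts H s v = 0.

Lemma shifts_linear E (H : {linear E -> E}) s : linear (shifts H s).
Proof.
elim: s => //= r s IH a v w; rewrite -IH; congr (shifts _ _ _).
by rewrite linearP scalerDr scalerBr !scalerA mulrC opprD addrACA.
Qed.

HB.instance Definition _ E (H : {linear E -> E}) s :=
  GRing.isLinear.Build K E E *:%R (shifts H s) (shifts_linear H s).

Lemma shifts_cat E (H : E -> E) s s' v :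
  shifts H (s ++ s') v = shifts H s' (shifts H s v).
Proof. by elim: s v => //= r s IH v. Qed.

Lemma shifts_map E E' (H : E -> E) (H' : E' -> E') (T : {linear E -> E'}) s v :
  (forall w, T (H w) = H' (T w)) -> T (shifts H s v) = shifts H' s (T v).
Proof.
move=> HT; elim: s v => //= r s IH v.
by rewrite IH linearB linearZ HT.
Qed.

Lemma shift_comm E (H : {linear E -> E}) s r v :
  shifts H s (H v - r *: v) = H (shifts H s v) - r *: shifts H s v.
Proof.
by rewrite linearB linearZ /= (shifts_map (T := H) (H' := H)).
Qed.

Lemma shiftsC E (H : {linear E -> E}) s s' v :
  shifts H s (shifts H s' v) = shifts H s' (shifts H s v).
Proof.
elim: s v => //= r s IH v; rewrite -IH; congr (shifts _ _ _).
by rewrite shift_comm.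
Qed.

Lemma gen_eig_linear E (H : {linear E -> E}) C a v w :
  gen_eig H C v -> gen_eig H C w -> gen_eig H C (a *: v + w).
Proof.
move=> [s sC sv] [s' sC' sw]; exists (s ++ s').
  by move=> r; rewrite mem_cat => /orP[/sC|/sC'].
by rewrite shifts_linear !shifts_cat sv shiftsC sw !linear0 addr0.
Qed.

Lemma gen_eig0 E (H : E -> E) C : gen_eig H C 0.
Proof. by exists [::]. Qed.

Lemma gen_eigD E (H : {linear E -> E}) C v w :
  gen_eig H C v -> gen_eig H C w -> gen_eig H C (v + w).
Proof. by move=> Gv Gw; have := gen_eig_linear 1 Gv Gw; rewrite scale1r. Qed.

Lemma gen_eig_shift E (H : E -> E) C r v :
  C r -> gen_eig H C (H v - r *: v) -> gen_eig H C v.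
Proof.
move=> Cr [s sC sv]; exists (r :: s) => // t.
by rewrite inE => /predU1P[->|/sC].
Qed.

Lemma gen_eig_eigen E (H : E -> E) C r v : C r -> H v = r *: v -> gen_eig H C v.
Proof. by move=> Cr Hv; apply: (gen_eig_shift Cr); rewrite Hv subrr; apply: gen_eig0. Qed.

Lemma gen_eig_sub E (H : E -> E) C C' v :
  (forall r, C r -> C' r) -> gen_eig H C v -> gen_eig H C' v.
Proof. by move=> CC [s sC sv]; exists s => // r /sC/CC. Qed.

Lemma gen_eig_map E E' (H : E -> E) (H' : E' -> E') (T : {linear E -> E'}) C v :
  (forall w, T (H w) = H' (T w)) -> gen_eig H C v -> gen_eig H' C (T v).
Proof.
by move=> HT [s sC sv]; exists s => //; rewrite -(shifts_map _ _ HT) sv linear0.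
Qed.

(** Since $(H-r-m)X=X(H-r)$, adding [m] to each entry of an annihilating list for [v] gives one for
    [X v]. *)
Lemma gen_eig_stable E (H : E -> E) (X : {linear E -> E}) C m v :
  (forall w, H (X w) = X (H w) + m *: X w) -> (forall r, C r -> C (r + m)) ->
  gen_eig H C v -> gen_eig H C (X v).
Proof.
move=> HX Cm [s sC sv]; exists [seq r + m | r <- s].
  by move=> _ /mapP[r /sC/Cm ? ->].
elim: s v sv {sC} => /= [v ->|r s IH v /IH]; first exact: linear0.
by rewrite linearB linearZ HX scalerDl opprD addrACA addrAC subrr addr0.
Qed.

(** Induction on the first list gives $(H-r)v=0$ for its head $r$; then each factor $H-r'$ of the
    second list multiplies $v$ by $r-r'\neq 0$. *)
Lemma gen_eig_disjoint E (H : {linear E -> E}) C C' v :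
  (forall r, C r -> C' r -> False) -> gen_eig H C v -> gen_eig H C' v -> v = 0.
Proof.
move=> CC [s sC sv] [s' sC' sv']; elim: s sC v sv sv' => //= r s IH sC v sv sv'.
have {IH sv} Hv : H v = r *: v.
  apply/subr0_eq/IH => // [t ts|]; first by apply: sC; rewrite inE ts orbT.
  by rewrite shift_comm sv' linear0 scaler0 subr0.
have {sC} Cr : C r by apply: sC; rewrite mem_head.
elim: s' sC' sv' => //= r' s' IH sC'; rewrite Hv -scalerBl => sv'.
apply: IH => [t ts|]; first by apply: sC'; rewrite inE ts orbT.
move: sv'; rewrite linearZ /= => /eqP; rewrite scaler_eq0 subr_eq0 => /predU1P[rr|/eqP//].
by case: (CC r Cr); rewrite rr; apply: sC'; rewrite mem_head.
Qed.

(** If $(H-r)w_1=(H-r')w$, then $(H-r)(w-w_1)=(r'-r)w$ with $r'\neq r$; this drives an induction on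
    the annihilating list of [w]. *)
Lemma gen_eig_shift_inv E (H : {linear E -> E}) C r w :
  ~ C r -> gen_eig H C w -> exists2 w', gen_eig H C w' & H w' - r *: w' = w.
Proof.
move=> nCr [s sC sw].
suff [w' sw' Hw'] : exists2 w', shifts H s w' = 0 & H w' - r *: w' = w.
  by exists w' => //; exists s.
elim: s sC w sw => /= [_ w ->|r' s IH sC w sw].
  by exists 0; rewrite // linear0 scaler0 subr0.
have [t ts|w1 sw1 Hw1] := IH _ _ sw; first by apply: sC; rewrite inE ts orbT.
have rr : r' - r != 0.
  rewrite subr_eq0; apply/eqP => rr; apply: nCr.
  by rewrite -rr; apply: sC; rewrite mem_head.
have shB t v v' : H (v - v') - t *: (v - v') = H v - t *: v - (H v' - t *: v').
  by rewrite linearB scalerBr !opprD !opprK addrACA.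
have shZ t a v : H (a *: v) - t *: (a *: v) = a *: (H v - t *: v).
  by rewrite linearZ scalerBr !scalerA mulrC.
exists ((r' - r)^-1 *: (w - w1)).
  by rewrite shZ shB linearZ linearB /= sw sub0r shift_comm sw1
     linear0 scaler0 subrr oppr0 scaler0.
rewrite shZ shB Hw1 opprB [_ + (_ - _)]addrC addrA subrK -scalerBl scalerA mulVf //.
by rewrite scale1r.
Qed.

(** Induction on [s]: split $(H-r)v=w_1+w_2$ and solve $(H-r)v_2=w_2$ in the [C'] part; then
    $(H-r)(v-v_2)=w_1$ puts $v-v_2$ in the [C] part. *)
Lemma gen_eig_split E (H : {linear E -> E}) C C' s s' v :
  (forall r, C r -> C' r -> False) ->
  (forall r, r \in s -> C r) -> (forall r, r \in s' -> C' r) ->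
  shifts H s (shifts H s' v) = 0 ->
  exists v1 v2, [/\ v = v1 + v2, gen_eig H C v1 & gen_eig H C' v2].
Proof.
move=> CC sC sC'; elim: s sC v => /= [_ v sv|r s IH sC v].
  by exists 0, v; split; [rewrite add0r | exact: gen_eig0 | exists s'].
rewrite -shift_comm => /IH[t ts|w1 [w2 [Hv Gw1 Gw2]]].
  by apply: sC; rewrite inE ts orbT.
have Cr : C r by apply: sC; rewrite mem_head.
have [v2 Gv2 Hv2] := gen_eig_shift_inv (fun C'r => CC r Cr C'r) Gw2.
exists (v - v2), v2; split=> //; first by rewrite subrK.
apply: (gen_eig_shift Cr); rewrite linearB scalerBr !opprD !opprK addrACA Hv -Hv2.
by rewrite -[- H v2 + _]opprK opprD !opprK addrK.
Qed.

(** Because $H_W-(r+r')$ sends $b(u,v)$ to $b((H_U-r)u,v)+b(u,(H_V-r')v)$, a nested induction on the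
    two lists applies. *)
Lemma gen_eig_bilinear (U V W : lmodType K) (b : U -> V -> W)
    (HU : {linear U -> U}) (HV : {linear V -> V}) (HW : {linear W -> W})
    C C' C'' u v :
  bilinear_map b -> (forall u v, HW (b u v) = b (HU u) v + b u (HV v)) ->
  (forall r r', C r -> C' r' -> C'' (r + r')) ->
  gen_eig HU C u -> gen_eig HV C' v -> gen_eig HW C'' (b u v).
Proof.
move=> [bl br] Hb CC [s sC su] [s' sC' sv].
have b0 w : b 0 w = 0 by have := bl w (-1) 0 0; rewrite scaler0 addr0 scaleN1r addNr.
have b0r w : b w 0 = 0 by have := br w (-1) 0 0; rewrite scaler0 addr0 scaleN1r addNr.
elim: s sC u su s' sC' v sv => /= [_ u ->|r s IH sC u su].
  by move=> *; rewrite b0; apply: gen_eig0.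
elim=> /= [_ v ->|r' s' IH' sC' v sv]; first by rewrite b0r; apply: gen_eig0.
have rC : C r by apply: sC; rewrite mem_head.
have rC' : C' r' by apply: sC'; rewrite mem_head.
apply: (gen_eig_shift (CC _ _ rC rC')).
have -> : HW (b u v) - (r + r') *: b u v =
    b (HU u - r *: u) v + b u (HV v - r' *: v).
  rewrite Hb -(addrC (- (r *: u))) -(scaleNr r u) bl.
  rewrite -(addrC (- (r' *: v))) -(scaleNr r' v) br.
  by rewrite !scaleNr scalerDl opprD addrACA ![- _ + b _ _]addrC.
apply: gen_eigD.
  apply: (IH _ _ su (r' :: s')) => // t ts.
  by apply: sC; rewrite inE ts orbT.
by apply: IH' => // t ts; apply: sC'; rewrite inE ts orbT.
Qed.

End GeneralizedEigenvectors.

(** * Linearity of brackets and actions *)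

Section LieBasics.
Context (K : fieldType).

HB.instance Definition _ (L : lieAlgType K) (M : lieModule L) (x : L) :=
  GRing.isLinear.Build K M M *:%R (act x) (act_linearr x).

HB.instance Definition _ (L : lieAlgType K) (x : L) :=
  GRing.isLinear.Build K L L *:%R (lie x) (lie_linearr x).

Lemma lieC (L : lieAlgType K) (x y : L) : lie x y = - lie y x.
Proof.
have lDl (z u v : L) : lie (u + v) z = lie u z + lie v z.
  by have := lie_linearl z 1 u v; rewrite !scale1r.
apply/eqP; rewrite -addr_eq0; apply/eqP.
by have := lie_alt (x + y); rewrite linearD /= !lDl !lie_alt add0r addr0 addrC.
Qed.

Lemma lieDl (L : lieAlgType K) (z x y : L) : lie (x + y) z = lie x z + lie y z.
Proof. by have := lie_linearl z 1 x y; rewrite !scale1r. Qed.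

Lemma lie0l (L : lieAlgType K) (z : L) : lie 0 z = 0.
Proof. by rewrite lieC linear0 oppr0. Qed.

Lemma lieZl (L : lieAlgType K) (z x : L) a : lie (a *: x) z = a *: lie x z.
Proof. by have := lie_linearl z a x 0; rewrite addr0 lie0l addr0. Qed.

Context (L : lieAlgType K) (M : lieModule L).

Lemma actDl (x y : L) (v : M) : act (x + y) v = act x v + act y v.
Proof. by have := act_linearl v 1 x y; rewrite !scale1r. Qed.

Lemma act0l (v : M) : act 0 v = 0.
Proof. by apply: (addrI (act 0 v)); rewrite -actDl !addr0. Qed.

Lemma actZl a (x : L) (v : M) : act (a *: x) v = a *: act x v.
Proof. by have := act_linearl v a x 0; rewrite addr0 act0l addr0. Qed.

Lemma act_comm (x y : L) (v : M) :
  act x (act y v) = act y (act x v) + act (lie x y) v.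
Proof. by rewrite act_lie addrC subrK. Qed.

End LieBasics.

(** * Linearly closed predicates and generation by pure tensors *)

Section LinearClosed.
Context (K : fieldType).

Definition linear_closed_set (V : lmodType K) (P : V -> Prop) : Prop :=
  P 0 /\ forall a v w, P v -> P w -> P (a *: v + w).

Lemma linear_closed_sum (V : lmodType K) (P : V -> Prop) (I : Type) (r : seq I)
    (c : I -> K) (F : I -> V) :
  linear_closed_set P -> (forall i, P (F i)) -> P (\sum_(i <- r) c i *: F i).
Proof.
move=> [P0 PD] PF; elim: r => [|i r IH]; first by rewrite big_nil.
by rewrite big_cons; apply: PD.
Qed.

(** A subspace of maximal dimension inside [P] absorbs every vector of [P], since adjoining the line
    of such a vector stays inside [P]. *)
Lemma linear_closed_vspace (V : vectType K) (P : V -> Prop) :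
  linear_closed_set P -> exists W : {vspace V}, forall v, v \in W <-> P v.
Proof.
move=> [P0 PD].
pose inP (W : {vspace V}) := forall v, v \in W -> P v.
pose D d := `[< exists2 W, inP W & \dim W = d >].
have D0 : exists d, D d.
  by exists 0%N; apply/asboolP; exists 0%VS; rewrite ?dimv0 // => v; rewrite memv0 => /eqP->.
have Dm d : D d -> (d <= \dim {:V})%N.
  by move=> /asboolP[W _ <-]; apply: dimvS; apply: subvf.
case: (ex_maxnP D0 Dm) => d /asboolP[W WP dW] dmax.
exists W => v; split; [exact: WP | move=> Pv].
have WvP : inP (W + <[v]>)%VS.
  move=> _ /memv_addP[w wW [_ /vlineP[a ->] ->]].
  by rewrite addrC; apply: PD => //; apply: WP.
have /dmax : D (\dim (W + <[v]>)) by apply/asboolP; exists (W + <[v]>)%VS.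
rewrite -dW => le; have : (W == W + <[v]>)%VS by rewrite eqEdim addvSl.
by move/eqP ->; apply: (subvP (addvSr _ _)); apply: memv_line.
Qed.

(* The universal property applied to the subspace P itself gives a retraction
   of T onto P fixing all pure tensors, which by uniqueness is the identity. *)
Section TensorGeneration.
Context (U V T : lmodType K) (tau : U -> V -> T) (P : T -> Prop).
Hypothesis Pl : linear_closed_set P.
Hypothesis Ptau : forall u v, P (tau u v).

Let inP : pred T := fun t => `[< P t >].
Let inP_closed : submod_closed inP.
Proof.
case: Pl => P0 PD; split; first exact/asboolP.
by move=> a v w /asboolP Pv /asboolP Pw; apply/asboolP/PD.
Qed.
HB.instance Definition _ := GRing.isSubmodClosed.Build K T inP inP_closed.

Let sub := {t : T | inP t}.
HB.instance Definition _ := SubChoice.on sub.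
HB.instance Definition _ := [SubChoice_isSubLmodule of sub by <:].

Lemma tensor_generated : tensor_product tau -> forall t, P t.
Proof.
move=> [[tl tr] univ] t.
pose b u v : sub := exist _ (tau u v) (introT (asboolP _) (Ptau u v)).
have bb : bilinear_map b.
  split=> w a x y; apply: val_inj; rewrite linearP /=; [exact: tl|exact: tr].
have [f [fE _]] := univ _ _ bb.
have [i [iE iU]] := univ T tau (conj tl tr).
have fi : (val \o f : {linear T -> T}) =1 i by apply: iU => u v /=; rewrite fE.
have ii : idfun =1 i by apply: (iU idfun).
by rewrite [t]ii -fi /=; apply/asboolP/(valP (f t)).
Qed.
End TensorGeneration.

End LinearClosed.

(** * Elements $x\otimes t^kf(t)$ of the loop algebra *)

Section LoopPoly.
Context (K : fieldType) (g : lieAlgType K).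
Implicit Types (k l : int) (x y : g) (f h : {poly K}).

(* The element x \otimes t^k f(t). *)
Definition loop_poly k x f : loop g := \sum_(i < size f) f`_i *: loop_mono (k + i%:Z) x.

Lemma loop_poly_wide n k x f : (size f <= n)%N ->
  loop_poly k x f = \sum_(i < n) f`_i *: loop_mono (k + i%:Z) x.
Proof.
move=> le; rewrite /loop_poly (big_ord_widen n (fun i => f`_i *: loop_mono (k + i%:Z) x)) //.
rewrite big_mkcond; apply: eq_bigr => i _; case: ltnP => // /(nth_default 0) ->.
by rewrite scale0r.
Qed.

Lemma loop_poly_linear k x : linear (loop_poly k x).
Proof.
move=> a f h; pose n := maxn (size (a *: f + h)) (maxn (size f) (size h)).
rewrite !(@loop_poly_wide n) ?leq_max ?leqnn ?orbT // scaler_sumr -big_split /=.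
by apply: eq_bigr => i _; rewrite coefD coefZ scalerDl scalerA.
Qed.
HB.instance Definition _ k x := GRing.isLinear.Build K {poly K} (loop g) *:%R
  (loop_poly k x) (loop_poly_linear k x).

Lemma loop_poly_linearl k f a x y :
  loop_poly k (a *: x + y) f = a *: loop_poly k x f + loop_poly k y f.
Proof.
rewrite /loop_poly scaler_sumr -big_split /=; apply: eq_bigr => i _.
by rewrite /loop_mono mono_linear scalerDr !scalerA mulrC.
Qed.

Lemma loop_polyC k x c : loop_poly k x c%:P = c *: loop_mono k x.
Proof.
by rewrite (@loop_poly_wide 1) ?size_polyC_leq1 // big_ord1 coefC addr0.
Qed.

Lemma loop_poly1 k x : loop_poly k x 1 = loop_mono k x.
Proof. by rewrite -polyC1 loop_polyC scale1r. Qed.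

Lemma loop_polyMX k x f : loop_poly k x (f * 'X) = loop_poly (k + 1) x f.
Proof.
rewrite (@loop_poly_wide (size f).+1); last first.
  by rewrite (leq_trans (size_polyMleq _ _)) // size_polyX addn2.
rewrite big_ord_recl coefMX scale0r add0r; apply: eq_bigr => i _.
by rewrite coefMX /= -addrA.
Qed.

(** The induction writes a polynomial as $fX+c$ and absorbs $X$ into the power of $t$, which leaves
    only brackets of monomials. *)
Lemma lie_loop_poly k l x y f h :
  lie (loop_poly k x f) (loop_poly l y h) = loop_poly (k + l) (lie x y) (f * h).
Proof.
have lie1 j c : lie (loop_mono j x) (loop_poly l y c) = loop_poly (j + l) (lie x y) c.
  elim/poly_ind: c l => [|c a IH] i; first by rewrite !linear0.
  rewrite !linearD /= !loop_polyMX IH addrA !loop_polyC linearZ /=.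
  by congr (_ + _ *: _); apply: loop_lie_mono.
elim/poly_ind: f k => [|f c IH] k; first by rewrite linear0 mul0r lie0l linear0.
rewrite linearD /= loop_polyMX lieDl IH loop_polyC lieZl lie1 mulrDl linearD /=.
by rewrite mul_polyC linearZ /= mulrAC loop_polyMX addrAC.
Qed.

Lemma ev_loop_poly (a : nonzero K) k x f :
  ev a (loop_poly k x f) = (val a ^ k * f.[val a]) *: x.
Proof.
elim/poly_ind: f k => [|f c IH] k.
  by rewrite linear0 horner0 mulr0 scale0r /ev msupp0 big_seq_fset0.
rewrite linearD /= loop_polyMX loop_polyC addrC ev_linear IH ev_mono.
rewrite !hornerE scalerA -scalerDl expfzDr ?(valP a) // expr1z.
by congr (_ *: _); rewrite mulrDr addrC (mulrC c) mulrA mulrAC.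
Qed.

End LoopPoly.

(** * Integer gradings of $\mathfrak g$ and fundamental coweights *)

Section Grading.
Context (K : fieldType) (g : fdLieAlgType K).

Lemma basis_ind (V : vectType K) (X : seq V) (P : V -> Prop) :
  basis_of fullv X -> linear_closed_set P -> (forall v, v \in X -> P v) ->
  forall v, P v.
Proof.
move=> /andP[/eqP spanX _] Pl PX v.
have : v \in <<in_tuple X>>%VS by rewrite spanX memvf.
move/coord_span => ->; apply: linear_closed_sum => // i.
by apply: PX; apply: mem_nth.
Qed.

Lemma basis_neq0 (V : vectType K) (X : seq V) v :
  basis_of fullv X -> v \in X -> v != 0.
Proof.
move=> /andP[_ Xfree] vX; apply/eqP => v0; move: Xfree.
rewrite (perm_free (perm_to_rem vX)) free_cons v0.
by rewrite mem0v.
Qed.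

Lemma lie_leibniz (x y z : g) : lie x (lie y z) = lie (lie x y) z + lie y (lie x z).
Proof.
have := lie_jacobi x y z; rewrite (lieC z x) linearN /= (lieC z (lie x y)).
by move/eqP; rewrite subr_eq0 subr_eq => /eqP.
Qed.

Lemma gen_eig_ad (x y : g) : ad_diagonalizable x -> gen_eig (lie x) (fun=> True) y.
Proof.
move=> [X [Xb Xe]]; move: y; apply: (basis_ind Xb).
  by split=> [|a v w]; [exact: gen_eig0 | exact: gen_eig_linear].
by move=> v /Xe[c]; apply: gen_eig_eigen.
Qed.

(** If every element of [h] is scalar on [W], any nonzero vector serves. Otherwise some [x] in [h]
    has an eigenspace in [W] that is nonzero, smaller than [W], and stable because [h] is
    abelian. *)
Lemma toral_common_eigenvector (h W : {vspace g}) :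
  toral h -> W != 0%VS ->
  (forall x y, x \in h -> y \in W -> lie x y \in W) ->
  exists2 y, y != 0 /\ y \in W & forall x, x \in h -> exists c, lie x y = c *: y.
Proof.
move=> [hC hD]; have [n] := ubnP (\dim W); elim: n W => // n IH W dW W0 hW.
have [hs|] := pselect (forall x, x \in h -> exists c, forall y, y \in W -> lie x y = c *: y).
  exists (vpick W); first by rewrite vpick0 memv_pick.
  by move=> x /hs[c cE]; exists c; apply: cE; rewrite memv_pick.
move=> /existsNP[x /not_implyP[xh nsc]].
have [c [y [y0 yW yc]]] : exists c y, [/\ y != 0, y \in W & lie x y = c *: y].
  (* Apply the factors of an annihilating list one at a time: the last nonzero vector is an
     eigenvector. *)
  have [s _] := gen_eig_ad (vpick W) (hD x xh).
  have := memv_pick W; move: (vpick W) (vpick0 W); rewrite (negPf W0).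
  elim: s => /= [y /negbT y0 yW yE|r s IHs y /negbT y0 yW ys].
    by rewrite yE eqxx in y0.
  have [yr|/negbTE yr] := eqVneq (lie x y - r *: y) 0.
    by exists r, y; rewrite y0 yW; split=> //; apply/subr0_eq.
  by apply: IHs yr _ ys; rewrite memvB ?memvZ ?hW.
have [|W' W'P] := @linear_closed_vspace _ g (fun y => y \in W /\ lie x y = c *: y).
  split=> [|a v w [vW vc] [wW wc]]; first by rewrite mem0v linear0 scaler0.
  by rewrite memvD ?memvZ // linearP /= vc wc scalerDr !scalerA mulrC.
have W'W : (W' <= W)%VS by apply/subvP => v /W'P[].
have [||z u zh /W'P[uW uc]|v [v0 /W'P[vW _]] hv] := IH W'.
- rewrite -ltnS (leq_trans _ dW) // ltnS ltn_neqAle dimvS // andbT.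
  apply/eqP => dWW; have WW : W' = W by apply/eqP; rewrite eqEdim W'W dWW leqnn.
  by apply: nsc; exists c => v; rewrite -WW => /W'P[].
- apply/eqP => W'0; move: y0; have /W'P : y \in W /\ lie x y = c *: y by [].
  by rewrite W'0 memv0 => ->.
- apply/W'P; split; first exact: hW.
  by rewrite lie_leibniz (hC x z) // lie0l add0r uc linearZ.
by exists v.
Qed.

Context (D : cartanDatum g).

Definition is_int (c : K) : Prop := exists m : int, c = m%:~R.

(** [dual_app] with its arguments exchanged, so that it carries a linear structure in the form. *)
Definition eval_at (h : {vspace g}) (x : subvs_of h) (lambda : dual h) : K :=
  dual_app lambda x.

Lemma eval_at_linear (h : {vspace g}) (x : subvs_of h) :
  linear (eval_at x : dual h -> K^o).
Proof. by move=> a l m; rewrite /eval_at /dual_app add_lfunE scale_lfunE. Qed.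
HB.instance Definition _ (h : {vspace g}) (x : subvs_of h) :=
  GRing.isLinear.Build K (dual h) K^o *:%R (eval_at x) (eval_at_linear x).

Lemma root_int (x : subvs_of (csa D)) beta :
  (forall i, is_int (dual_app (sroot i) x)) ->
  is_root beta -> is_int (dual_app beta x).
Proof.
move=> xint rb; have comb b : nonneg_comb (@sroot _ _ D) b -> is_int (dual_app b x).
  move=> [c ->]; rewrite -/(eval_at x _) linear_sum /=.
  elim/big_rec: _ => [|i _ _ [m ->]]; first by exists 0.
  have [k kE] := xint i; exists (k *+ c i + m).
  by rewrite rmorphD rmorphMn /= -kE raddfMn.
case: (srootP D) => _ _ /(_ _ rb)[/comb//|/comb[m mE]].
by exists (- m); rewrite rmorphN /= -mE -!/(eval_at x _) linearN opprK.
Qed.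

(** The [c]-eigenspace of $\mathrm{ad}\,x$ is stable under the Cartan subalgebra, so it contains a
    common eigenvector. Its weight is zero or a root, and has the value [c] at [x]. *)
Lemma ad_eig_int (x : subvs_of (csa D)) v c :
  (forall i, is_int (dual_app (sroot i) x)) ->
  v != 0 -> lie (vsval x) v = c *: v -> is_int c.
Proof.
move=> xint v0 vc; have [htor _] := csaP D; have [hC _] := htor.
have [|W WP] := @linear_closed_vspace _ g (fun y => lie (vsval x) y = c *: y).
  split=> [|a u w uc wc]; first by rewrite linear0 scaler0.
  by rewrite linearP /= uc wc scalerDr !scalerA mulrC.
have [||y [y0 /WP yc] hy] := @toral_common_eigenvector _ W htor.
- by apply/eqP => W0; move/WP: vc; rewrite W0 memv0 (negPf v0).
- move=> z u zh /WP uc; apply/WP.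
  by rewrite lie_leibniz (hC _ z) ?subvsP // lie0l add0r uc linearZ.
have [b bE] := choice (fun z : subvs_of (csa D) => hy _ (subvsP z)).
have blin : linear (b : subvs_of (csa D) -> K^o).
  move=> a u w; apply/eqP; have := bE (a *: u + w).
  rewrite linearP lie_linearl /= !bE scalerA -scalerDl => /eqP.
  by rewrite -subr_eq0 -scalerBl scaler_eq0 (negPf y0) orbF subr_eq0 eq_sym.
pose bl : {linear subvs_of (csa D) -> K^o} := HB.pack b (GRing.isLinear.Build _ _ _ _ _ blin).
pose beta : dual (csa D) := linfun bl.
have betaE z : dual_app beta z = b z by rewrite /dual_app lfunE.
have -> : c = dual_app beta x.
  apply/eqP; have := bE x; rewrite yc betaE => /eqP.
  by rewrite -subr_eq0 -scalerBl scaler_eq0 (negPf y0) orbF subr_eq0.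
have [->|/eqP b0] := eqVneq beta 0.
  by exists 0; rewrite /dual_app zero_lfunE.
apply: root_int => //; split=> //; exists y; split; first exact/eqP.
by move=> z; rewrite betaE.
Qed.

Lemma grading_ind (x : subvs_of (csa D)) (P : g -> Prop) :
  (forall i, is_int (dual_app (sroot i) x)) -> linear_closed_set P ->
  (forall (m : int) y, lie (vsval x) y = m%:~R *: y -> P y) -> forall y, P y.
Proof.
move=> xint Pl Pm; have [[_ hD] _] := csaP D.
have [X [Xb Xe]] := hD _ (subvsP x).
apply: (basis_ind Xb) => // v vX; have [c vc] := Xe v vX.
have [m cm] := ad_eig_int xint (basis_neq0 Xb vX) vc.
by apply: (Pm m); rewrite -cm.
Qed.

Lemma sroot_free (u : 'I_(rk D) -> K) :
  \sum_i u i *: sroot i = 0 -> forall i, u i = 0.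
Proof.
case: (srootP D) => _ /andP[_ sfree] _ u0 i.
have := @freeP _ _ _ (codom_tuple (@sroot _ _ D)); move/(_ sfree) => fr.
have [|v0] := pselect (\sum_(j < #|'I_(rk D)|) u (enum_val j) *:
    (codom_tuple (@sroot _ _ D))`_j = 0).
  by move/(fr (fun j => u (enum_val j)))/(_ (enum_rank i)); rewrite enum_rankK.
case: v0; rewrite -[RHS]u0
  [RHS](reindex (fun j : 'I_#|'I_(rk D)| => enum_val j)) /=; last first.
  by exists enum_rank => j _; rewrite ?enum_valK ?enum_rankK.
apply: eq_bigr => j _; rewrite (nth_map (enum_val j)) /=; last by rewrite -cardT.
by congr (_ *: sroot _); rewrite -enum_val_nth.
Qed.

Lemma sroot_span (lambda : dual (csa D)) : exists c, lambda = \sum_i c i *: sroot i.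
Proof.
case: (srootP D) => _ sb _; move: lambda; apply: (basis_ind sb).
  split; first by exists (fun=> 0); rewrite big1 // => i _; rewrite scale0r.
  move=> a _ _ [c ->] [d ->]; exists (fun i => a * c i + d i).
  by rewrite scaler_sumr -big_split; apply: eq_bigr => i _; rewrite scalerDl scalerA.
move=> _ /codomP[i ->]; exists (fun j => (j == i)%:R).
rewrite (bigD1 i) //= eqxx scale1r big1 ?addr0 // => j /negPf->.
by rewrite scale0r.
Qed.

(** The matrix [A] of the simple roots in a basis of the Cartan subalgebra has independent rows,
    hence a right inverse [B], whose columns are the coordinates of the coweights. *)
Lemma fundamental_coweights : exists w : 'I_(rk D) -> subvs_of (csa D),
  forall i j, dual_app (sroot j) (w i) = (j == i)%:R.
Proof.
pose e := vbasis {:subvs_of (csa D)}.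
pose A := \matrix_(j < rk D, k < \dim {:subvs_of (csa D)}) dual_app (@sroot _ _ D j) e`_k.
have /row_freeP[B AB] : row_free A.
  apply: inj_row_free => u uA; apply/rowP => i; rewrite mxE.
  apply: (@sroot_free (u 0)); apply/lfunP => x; rewrite zero_lfunE.
  rewrite (coord_vbasis (memvf x)) linear_sum big1 //= => k _.
  rewrite linearZ /= sum_lfunE.
  have := congr1 (fun m : 'rV_ _ => m 0 k) uA; rewrite !mxE => uAk.
  apply/eqP; rewrite scaler_eq0; apply/orP; right; apply/eqP.
  by rewrite -[RHS]uAk; apply: eq_bigr => j _; rewrite !mxE scale_lfunE.
exists (fun i => \sum_k B k i *: e`_k) => i j.
have := congr1 (fun m : 'M_ _ => m j i) AB; rewrite !mxE => <-.
rewrite /dual_app linear_sum; apply: eq_bigr => k _.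
by rewrite !mxE linearZ mulrC.
Qed.

Lemma sroot_coords (w : 'I_(rk D) -> subvs_of (csa D)) (lambda : dual (csa D)) :
  (forall i j, dual_app (sroot j) (w i) = (j == i)%:R) ->
  lambda = \sum_i dual_app lambda (w i) *: sroot i.
Proof.
move=> wE; have [c lE] := sroot_span lambda.
rewrite [LHS]lE; apply: eq_bigr => i _; congr (_ *: _).
rewrite lE -/(eval_at _ _) linear_sum /= (bigD1 i) //= linearZ /= /eval_at.
rewrite wE eqxx [_ *: _]mulr1 big1 ?addr0 // => j /negPf ji.
by rewrite -/(eval_at _ _) linearZ /= /eval_at wE ji [_ *: _]mulr0.
Qed.

End Grading.

(** * Spectral types and their behaviour under extensions *)

Section SpectralType.
Context (K : fieldType) (g : fdLieAlgType K).

Definition int_coset (c r : K) : Prop := is_int (r - c).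

Lemma is_intD (c d : K) : is_int c -> is_int d -> is_int (c + d).
Proof. by move=> [m ->] [n ->]; exists (m + n); rewrite rmorphD. Qed.

Lemma is_intN (c : K) : is_int c -> is_int (- c).
Proof. by move=> [m ->]; exists (- m); rewrite rmorphN. Qed.

Lemma int_coset_refl c : int_coset c c.
Proof. by exists 0; rewrite subrr. Qed.

Lemma int_coset_int c r (m : int) : int_coset c r -> int_coset c (r + m%:~R).
Proof. by move=> rc; rewrite /int_coset addrAC; apply: is_intD => //; exists m. Qed.

Lemma int_coset_trans c d r : is_int (c - d) -> int_coset c r -> int_coset d r.
Proof.
move=> icd rc; rewrite /int_coset (_ : r - d = (r - c) + (c - d)).
  exact: is_intD.
by rewrite addrA subrK.
Qed.

Lemma int_cosetD c c' r r' :
  int_coset c r -> int_coset c' r' -> int_coset (c + c') (r + r').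
Proof. by move=> rc rc'; rewrite /int_coset opprD addrACA; apply: is_intD. Qed.

(** [J] is the derived algebra, cut out as the smallest subspace containing all brackets. It is an
    ideal, and nonzero because $\mathfrak g$ is not abelian. *)
Lemma simple_perfect (P : g -> Prop) : simple_lie g -> linear_closed_set P ->
  (forall x y, P (lie x y)) -> forall z, P z.
Proof.
move=> [[x [y xy]] simp] Pl Plie z.
pose J u := forall Q : g -> Prop, linear_closed_set Q ->
  (forall x y, Q (lie x y)) -> Q u.
have [|W WJ] := @linear_closed_vspace _ g J.
  split=> [Q [] //|a v w Jv Jw Q Ql Qlie]; case: (Ql) => _; apply.
    exact: Jv.
  exact: Jw.
have [u v _||WT] := simp W.
- by apply/WJ => Q _.
- move=> W0; case: xy; apply/eqP; rewrite -memv0 -W0.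
  by apply/WJ => Q _.
have /WJ : z \in W by rewrite WT memvf.
exact.
Qed.

(** Annihilation by $\mathfrak g\otimes I$, where $I$ is the ideal of $K[t,t^{-1}]$ generated by
    [p]; [k] supplies the negative powers of $t$. Taking a subset [B] covers the terms of a
    filtration. *)
Definition kills (M : lieModule (loop g)) (B : set M) (p : {poly K}) : Prop :=
  forall k x f v, B v -> p %| f -> act (loop_poly k x f) v = 0.

(* When q %| e, e.[a] = 1 and e is idempotent modulo a power of ('X - a) * q that
   kills the module, w \otimes e is the component at a of w. *)
Definition spectral_type (a : K) (w : g) (c : K) (M : lieModule (loop g))
    (B : set M) : Prop :=
  exists (q : {poly K}) (N : nat),
    [/\ q.[a] != 0, kills B ((('X - a%:P) * q) ^+ N)
      & forall e, e.[a] = 1 -> q %| e -> forall v, B v ->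
          gen_eig (act (loop_poly 0 w e)) (int_coset c) v].

Lemma kills_dvd (M : lieModule (loop g)) (B : set M) p p' :
  p %| p' -> kills B p -> kills B p'.
Proof. by move=> pp kp k x f v Bv pf; apply: kp => //; apply: dvdp_trans pf. Qed.

Section Extension.
Context (M N : lieModule (loop g)) (A B : set M).
Hypothesis g_simple : simple_lie g.
Hypothesis subB : submodule B.
Hypothesis BAN : subquotient_iso A B N.

(** $\mathfrak g\otimes(p)$ maps [B] into [A] and annihilates [A], so brackets of two such elements
    kill [B]. As $\mathfrak g=[\mathfrak g,\mathfrak g]$, these brackets span $\mathfrak
    g\otimes(p^2)$. *)
Lemma kills_extension p : kills A p -> kills (@setT N) p -> kills B (p * p).
Proof.
case: BAN => q [qlin qact _ qker]; have [B0 BD BX] := subB => kA kN.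
have actA k x f v : B v -> p %| f -> A (act (loop_poly k x f) v).
  by move=> Bv pf; apply/qker; [exact: BX | rewrite qact // kN].
move=> k x f v Bv /dvdpP[h ->]; move: x; apply: (simple_perfect g_simple).
  split=> [|a x y Hx Hy]; last first.
    by rewrite loop_poly_linearl act_linearl Hx Hy scaler0 addr0.
  rewrite /loop_poly big1 ?act0l // => i _.
  by rewrite /loop_mono /mono monalgU0 scaler0.
move=> x y; rewrite mulrA -[k]addr0 -lie_loop_poly act_lie.
have php : p %| h * p by apply: dvdp_mull.
rewrite (kA k x _ (act (loop_poly 0 y p) v)) //; last exact: actA.
by rewrite (kA 0 y _ (act (loop_poly k x (h * p)) v)) ?subrr //; apply: actA.
Qed.

(** A list for the image in [N] moves [v] into [A]; a list for the result is appended to it. *)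
Lemma gen_eig_extension (x : loop g) C :
  (forall v, A v -> gen_eig (act x) C v) -> (forall u : N, gen_eig (act x) C u) ->
  forall v, B v -> gen_eig (act x) C v.
Proof.
case: BAN => q [qlin qact _ qker]; have [B0 BD BX] := subB => gA gN v Bv.
have [s sC sq] := gN (q v).
(* [q] is linear and equivariant only on [B], so membership in [B] is carried along. *)
have qs : B (shifts (act x) s v) /\ q (shifts (act x) s v) = shifts (act x) s (q v).
  elim: s v Bv {sC sq} => //= r s IH v Bv.
  have Bs : B (act x v - r *: v) by rewrite addrC -scaleNr; apply: BD => //; apply: BX.
  have [? ->] := IH _ Bs; split=> //; congr (shifts _ _ _).
  by rewrite addrC -scaleNr qlin ?qact ?scaleNr 1?addrC //; apply: BX.
have [s' sC' sq'] : gen_eig (act x) C (shifts (act x) s v).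
  by apply: gA; apply/qker; case: qs => // _ ->.
exists (s ++ s'); last by rewrite shifts_cat.
by move=> r; rewrite mem_cat => /orP[/sC|/sC'].
Qed.

(** With the product of the two polynomials, the exponent $n+n'$ serves for [A] and [N] alike; the
    factor 2 pays for [kills_extension]. *)
Lemma spectral_type_extension a w c :
  spectral_type a w c A -> spectral_type a w c (@setT N) -> spectral_type a w c B.
Proof.
move=> [q [n [qa kA gA]]] [q' [n' [qa' kN gN]]].
exists (q * q'), ((n + n') * 2)%N; split.
- by rewrite hornerM mulf_neq0.
- rewrite exprM expr2; apply: kills_extension.
    apply: kills_dvd kA; rewrite mulrA [X in _ %| X]exprMn dvdp_mulr //.
    by rewrite exprD dvdp_mulr.
  apply: kills_dvd kN; rewrite [q * _]mulrC mulrA [X in _ %| X]exprMn dvdp_mulr //.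
  by rewrite exprD dvdp_mull.
- move=> e ea qe; apply: gen_eig_extension.
    by apply: gA => //; apply: dvdp_trans qe; apply: dvdp_mulr.
  by move=> u; apply: gN => //; apply: dvdp_trans qe; apply: dvdp_mull.
Qed.

End Extension.

End SpectralType.

(** * Spectral types of the irreducible modules $V(\pi)$ *)

Section Highest.
Context (K : closedFieldType) (g : fdLieAlgType K) (D : cartanDatum g).
Context (w : subvs_of (csa D)).
Hypothesis w_int : forall i, is_int (dual_app (sroot i) w).

(** Since $\mathrm{ad}\,w$ has integer eigenvalues, the vectors with eigenvalues in one coset of
    $\mathbb Z$ form a submodule. It contains the highest weight vector, hence is all of [V]. *)
Lemma is_V_gen_eig (lambda : domWeight D) (V : lieModule g) (v : V) :
  is_V lambda V ->
  gen_eig (act (vsval w)) (int_coset (dual_app (wt (weight_of_dom lambda : weight D)) w)) v.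
Proof.
move=> [[_ Virr] [v0 [v00 _ v0w]]].
set C := int_coset _.
have sub : submodule (gen_eig (act (vsval w)) C : set V).
  split=> [|a u u'|x u]; [exact: gen_eig0|exact: gen_eig_linear|].
  move: x u; apply: (grading_ind w_int).
    split=> [u _|a x y Hx Hy u Gu]; first by rewrite act0l; apply: gen_eig0.
    by rewrite act_linearl; apply: gen_eig_linear; [exact: Hx|exact: Hy].
  move=> m y wy u; apply: (gen_eig_stable (m := m%:~R)).
    by move=> u'; rewrite act_comm wy actZl.
  by move=> r; apply: int_coset_int.
have Gv0 : gen_eig (act (vsval w)) C v0.
  exact: gen_eig_eigen (int_coset_refl _) (v0w w).
case: (Virr _ sub) => ST; last by change ((gen_eig (act (vsval w)) C : set V) v); rewrite ST.
by have : (gen_eig (act (vsval w)) C : set V) v0 := Gv0; rewrite ST.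
Qed.

(* For s the factorization of pi, a lift to P of the value at a of chi_pi. *)
Definition weight_at (a : nonzero K) (s : seq (domWeight D * nonzero K)) : weight D :=
  \sum_(y <- s | y.2 == a) weight_of_dom y.1.

(** On the evaluation factor at $b$, $x\otimes t^kf$ acts as $b^kf(b)x$. *)
Lemma tensor_of_ev_kills (s : seq (domWeight D * nonzero K))
    (T : lieModule (loop g)) k x f (v : T) :
  is_tensor_of_ev s T -> (forall y, y \in s -> f.[val y.2] = 0) ->
  act (loop_poly k x f) v = 0.
Proof.
elim: s T v => [|[lambda b] s IH] T v /=; first by case.
move=> [V [T' [_ T's [tau [tauT tauX]]]]] fs; case: (tauT) => -[tl tr] _.
have t0 u : tau u 0 = 0 by have := tr u (-1) 0 0; rewrite scaler0 addr0 scaleN1r addNr.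
have t0l u : tau 0 u = 0 by have := tl u (-1) 0 0; rewrite scaler0 addr0 scaleN1r addNr.
move: v; apply: (tensor_generated _ _ tauT).
  by split=> [|a u u' Hu Hu']; rewrite ?linear0 // linearP /= Hu Hu' scaler0 addr0.
move=> u u'; rewrite tauX /= (IH _ u' T's) => [|y ys]; last first.
  by apply: fs; rewrite inE ys orbT.
by rewrite ev_loop_poly (fs (lambda, b)) ?mem_head // mulr0 scale0r act0l t0 t0l addr0.
Qed.

Lemma wtD : {morph (@wt K g D) : x y / x + y}.
Proof.
by move=> x y; rewrite /wt -big_split; apply: eq_bigr => i _; rewrite ffunE mulrzDr.
Qed.

Lemma wt0 : wt (0 : weight D) = 0.
Proof. by rewrite /wt big1 // => i _; rewrite ffunE. Qed.

(** The element $w\otimes e$ acts as $w$ on a factor at [a] and as zero on the others, and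
    eigenvalues add on pure tensors. *)
Lemma tensor_of_ev_gen_eig (s : seq (domWeight D * nonzero K))
    (T : lieModule (loop g)) (a : nonzero K) e (v : T) :
  is_tensor_of_ev s T -> e.[val a] = 1 ->
  (forall y, y \in s -> y.2 != a -> e.[val y.2] = 0) ->
  gen_eig (act (loop_poly 0 (vsval w) e))
    (int_coset (dual_app (wt (weight_at a s)) w)) v.
Proof.
move=> + ea; elim: s T v => [|[lambda b] s IH] T v /=.
  move=> [_ T0] _; apply: (@gen_eig_eigen _ _ _ _ 0); last by rewrite T0 scale0r.
  rewrite /weight_at big_nil /int_coset; exists 0.
  by rewrite wt0 /dual_app zero_lfunE subrr.
move=> [V [T' [Vl T's [tau [tauT tauX]]]]] es; case: (tauT) => taub _.
move: v; apply: (tensor_generated _ _ tauT).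
  by split=> [|c u u']; [exact: gen_eig0 | exact: gen_eig_linear].
move=> u u'.
pose C := int_coset (if b == a then dual_app (wt (weight_of_dom lambda : weight D)) w else 0).
pose C' := int_coset (dual_app (wt (weight_at a s)) w).
apply: (@gen_eig_bilinear _ _ _ _ tau (act (loop_poly 0 (vsval w) e))
  (act (loop_poly 0 (vsval w) e)) _ C C') => //.
- by move=> u1 u2 /=; rewrite tauX.
- move=> r r' /int_cosetD rC /rC; rewrite /weight_at big_cons /=.
  by case: eqP => _; rewrite ?add0r // wtD -!/(eval_at _ _) linearD.
- rewrite /C; have [ab|ab] := eqVneq b a.
    suff actE : @act _ _ (ev_module b V) (loop_poly 0 (vsval w) e) = @act _ _ V (vsval w).
      by have := is_V_gen_eig u Vl; rewrite -actE.
    by apply: funext => u1 /=; rewrite ev_loop_poly ab ea expr0z mulr1 scale1r.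
  apply: (@gen_eig_eigen _ _ _ _ 0); first exact: int_coset_refl.
  by rewrite /= ev_loop_poly (es (lambda, b)) ?mem_head // mulr0 !scale0r act0l.
- by apply: IH => // y ys; apply: es; rewrite inE ys orbT.
Qed.

(** [q] vanishes at every point of the factorization other than [a]. Exponent 1 suffices, since
    evaluation modules see only values at these points. *)
Lemma Vpi_spectral_type (pi : drinfeld D) (T : lieModule (loop g)) (a : nonzero K) :
  is_Vpi pi T ->
  spectral_type (val a) (vsval w) (dual_app (wt (weight_at a (factorization pi))) w)
    (@setT T).
Proof.
move=> Tpi; set s := factorization pi.
pose q := \prod_(y <- s | y.2 != a) ('X - (val y.2)%:P).
have q0 (y : domWeight D * nonzero K) : y \in s -> y.2 != a -> root q (val y.2).
  move=> ys ya; rewrite /q (big_rem y ys) /= ya rootM root_XsubC eqxx //.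
exists q, 1%N; split.
- rewrite horner_prod prodf_seq_neq0; apply/allP => y _; apply/implyP => ya.
  by rewrite hornerXsubC subr_eq0 val_eqE eq_sym.
- move=> k x f v _ /dvdpP[h ->]; apply: tensor_of_ev_kills Tpi _ => y ys.
  rewrite expr1 !hornerM hornerXsubC; have [->|ya] := eqVneq y.2 a.
    by rewrite subrr mul0r mulr0.
  by rewrite (rootP (q0 y ys ya)) !mulr0.
- move=> e ea /dvdpP[h eE] v _; apply: tensor_of_ev_gen_eig Tpi ea _ => y ys ya.
  by rewrite eE hornerM (rootP (q0 y ys ya)) mulr0.
Qed.

End Highest.

(** * Composition series and subquotients of finite-dimensional modules *)

Section CompositionSeries.
Context (K : fieldType) (L : lieAlgType K) (M : lieModule L).
Context (n : nat) (f : {linear 'rV[K]_n -> M}) (f' : M -> 'rV[K]_n).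
Hypotheses (fK : cancel f f') (f'K : cancel f' f).

(** Submodules are transported to subspaces of row vectors, where dimensions can be compared. *)
Let preim (S : set M) (W : {vspace 'rV[K]_n}) := forall v, v \in W <-> S (f v).

Let submodule_vspace S : submodule S -> exists W, preim S W.
Proof.
move=> [S0 SD _]; apply: (linear_closed_vspace (P := fun v => S (f v))).
by split=> [|a v w Sv Sw]; rewrite ?linear0 // linearP; apply: SD.
Qed.

Let preim_inj S S' W : preim S W -> preim S' W -> S = S'.
Proof.
move=> WS WS'; apply/seteqP; split=> v Sv; rewrite -[v]f'K.
  by apply/WS'/WS; rewrite f'K.
by apply/WS/WS'; rewrite f'K.
Qed.

Let preim_sub S S' W W' : preim S W -> preim S' W' -> S `<=` S' -> (W <= W')%VS.
Proof. by move=> WS WS' SS; apply/subvP => v /WS/SS/WS'. Qed.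

Let submoduleT : submodule (@setT M). Proof. by []. Qed.

(** The next term is a submodule of least dimension strictly above [S], so nothing lies in between;
    the induction is on the codimension of [S]. *)
Lemma composition_series_above S : submodule S ->
  exists k (F : nat -> set M),
  [/\ forall i, (i <= k)%N -> submodule (F i), F 0%N = S, F k = setT
    & forall i, (i < k)%N ->
        [/\ F i `<=` F i.+1, F i <> F i.+1
          & forall T, submodule T -> F i `<=` T -> T `<=` F i.+1 ->
              T = F i \/ T = F i.+1]].
Proof.
move=> subS; have [W WS] := submodule_vspace subS.
have [d] := ubnP (n - \dim W); elim: d S W subS WS => // d IH S W subS WS dW.
have [ST|nST] := pselect (S = setT).
  by exists 0%N, (fun=> S); split=> // i; rewrite ltn0.
pose D m := `[< exists S' W', [/\ submodule S', preim S' W', S `<=` S', S <> S'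
  & \dim W' = m] >].
have D0 : exists m, D m.
  have [W' WT] := submodule_vspace submoduleT.
  by exists (\dim W'); apply/asboolP; exists setT, W'.
case: (ex_minnP D0) => m /asboolP[S' [W' [subS' WS' SS' nSS' dW']]] mmin.
have dWW' : (\dim W < \dim W')%N.
  rewrite ltn_neqAle dimvS ?(preim_sub WS WS') // andbT; apply/eqP => dWW'.
  have /eqP WW' : W == W' by rewrite eqEdim (preim_sub WS WS') //= dWW'.
  by case: nSS'; apply: (preim_inj WS); rewrite WW'.
have [|k [F [Fsub F0 Fk Fs]]] := IH S' W' subS' WS'.
  rewrite -ltnS (leq_trans _ dW) // ltnS ltn_sub2l // (leq_trans dWW') //.
  by rewrite (leq_trans (dimvS (subvf _))) // dimvf /dim /= mul1n.
exists k.+1, (fun i => if i is j.+1 then F j else S); split=> //.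
  by case=> // i; rewrite ltnS => /Fsub.
case=> [_|i]; last by rewrite ltnS => /Fs.
rewrite F0; split=> // T subT ST TS'.
have [->|nST'] := pselect (T = S); [by left | right].
have [W'' WT] := submodule_vspace subT.
have W''W' := preim_sub WT WS' TS'.
have /mmin le : D (\dim W'').
  by apply/asboolP; exists T, W''; split=> // ST'; apply: nST'.
have /eqP WW : W'' == W' by rewrite eqEdim W''W' dW'.
by apply: (preim_inj WT); rewrite WW.
Qed.

Lemma f'_linear : linear f'.
Proof. exact: can2_linear fK f'K. Qed.

(** $B/A$ is modelled on the image of $B$ under a projection along $A$; an element acts on a
    representative and the result is projected back. *)
Lemma subquotient_exists (A B : set M) : submodule A -> submodule B -> A `<=` B ->
  exists N, subquotient_iso A B N.
Proof.
move=> subA subB AB; have [A0 AD AX] := subA; have [B0 BD BX] := subB.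
have [VA VAP] := submodule_vspace subA; have [VB VBP] := submodule_vspace subB.
have AN v : A v -> A (- v).
  by move=> Av; have := AD (-1) v 0 Av A0; rewrite addr0 scaleN1r.
pose pr := daddv_pi (VA^C) VA.
have capA : (VA^C :&: VA = 0)%VS by rewrite capvC capv_compl.
have prE v : v - pr v \in VA.
  have vin : v \in (VA^C + VA)%VS by rewrite addvC addv_complf memvf.
  by rewrite -{1}(daddv_pi_add capA vin) addrC addKr memv_pi.
have prA v : v \in VA -> pr v = 0.
  move=> vA; have : pr v \in (VA^C :&: VA)%VS.
    rewrite memv_cap memv_pi /=.
    by rewrite -[pr v]opprK -[- pr v](addKr v) memvN addrC memvB ?prE.
  by rewrite capA memv0 => /eqP.
pose VN := (pr @: VB)%VS.
pose q (v : M) : subvs_of VN := vsproj VN (pr (f' v)).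
have qlin a v w : q (a *: v + w) = a *: q v + q w.
  by rewrite /q f'_linear !linearP.
have qB v : B v -> vsval (q v) = pr (f' v).
  by move=> Bv; rewrite vsprojK // memv_img //; apply/VBP; rewrite f'K.
have qsurj y : exists2 v, B v & q v = y.
  have /memv_imgP[v vB yE] := subvsP y.
  exists (f v); first exact/VBP.
  by rewrite /q fK -yE vsvalK.
have qA v : B v -> (q v = 0 <-> A v).
  move=> Bv; split=> [q0|Av].
    have pr0 : pr (f' v) = 0 by rewrite -qB // q0.
    by have /VAP := prE (f' v); rewrite pr0 subr0 f'K.
  by apply: val_inj; rewrite /= qB // prA //; apply/VAP; rewrite f'K.
pose X (x : L) (y : subvs_of VN) := q (act x (f (vsval y))).
have qX x v : B v -> q (act x v) = X x (q v).
  move=> Bv; rewrite /X qB //; set v' := f _.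
  (* [v] and the representative [v'] differ by an element of [A], which [x] preserves and [q] sends
     to zero. *)
  have Av : A (v - v').
    by have /VAP := prE (f' v); rewrite linearB /= f'K.
  have {1}-> : v = 1 *: (v - v') + v' by rewrite scale1r subrK.
  rewrite linearP qlin; have /qA [_ ->] : B (act x (v - v')) by apply/BX/AB.
    by rewrite scaler0 add0r.
  exact: AX.
have Xlinl y a x x' : X (a *: x + x') y = a *: X x y + X x' y.
  by rewrite /X act_linearl qlin.
have Xlinr x a y y' : X x (a *: y + y') = a *: X x y + X x y'.
  by rewrite /X !linearP qlin.
have Xlie x x' y : X (lie x x') y = X x (X x' y) - X x' (X x y).
  have [v Bv <-] := qsurj y.
  rewrite -!qX ?act_lie; try by repeat apply: BX.
  by rewrite addrC -scaleN1r qlin scaleN1r addrC.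
exists (@LieModule K L (subvs_of VN) X Xlinl Xlinr Xlie).
by exists q; split=> // a v w _ _; apply: qlin.
Qed.
End CompositionSeries.

(** Climb a composition series: each term is an extension of a constituent by the term below it. *)
Lemma spectral_type_constituents (K : fieldType) (g : fdLieAlgType K) a w c
    (M : lieModule (loop g)) :
  simple_lie g -> finite_dim M ->
  (forall N : lieModule (loop g), constituent M N -> spectral_type a w c (@setT N)) ->
  spectral_type a w c (@setT M).
Proof.
move=> gs [n [f [f' fK f'K]]] cN.
have sub0 : submodule [set (0 : M)].
  split=> // [b v u -> ->|x v ->]; first by rewrite scaler0 addr0.
  exact: linear0.
have [k [F [Fsub F0 Fk Fs]]] := composition_series_above f'K sub0.
have cF : composition_series k F by [].
have Fi i : (i <= k)%N -> spectral_type a w c (F i).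
  elim: i => [_|i IH ik].
    exists 1, 0%N; rewrite F0; split=> [|l x h v -> _|e _ _ v ->].
    - by rewrite hornerC oner_neq0.
    - exact: linear0.
    - exact: gen_eig0.
  have subFi := Fsub _ (ltnW ik); have subFS := Fsub _ ik.
  have [FF _ _] := Fs _ ik.
  have [N qN] := subquotient_exists fK f'K subFi subFS FF.
  apply: (spectral_type_extension gs subFS qN); first exact/IH/ltnW.
  by apply: cN; exists k, F, i.
by rewrite -Fk; apply: Fi.
Qed.

(** * Splitting extensions whose eigenvalue cosets differ *)

Section Splitting.
Context (K : fieldType) (g : fdLieAlgType K) (w : g).
Hypothesis g_simple : simple_lie g.
Hypothesis w_grading : forall P : g -> Prop, linear_closed_set P ->
  (forall (m : int) y, lie w y = m%:~R *: y -> P y) -> forall y, P y.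

(** Bezout gives $u(X-a)^{n+1}+vq^{n+1}=1$, and $e=vq^{n+1}$. The exponent $n+1$ secures $e(a)=1$
    and $q\mid e$ even for $n=0$. *)
Lemma approximate_idempotent (q : {poly K}) a n : q.[a] != 0 ->
  exists e : {poly K}, [/\ e.[a] = 1, q %| e & (('X - a%:P) * q) ^+ n %| e * (1 - e)].
Proof.
move=> qa; have cop : coprimep (('X - a%:P) ^+ n.+1) (q ^+ n.+1).
  by rewrite coprimep_expl // coprimep_expr // coprimep_sym coprimep_XsubC rootE.
have /Bezout_eq1_coprimepP[[u v] /= uv] := cop.
have e1 : 1 - v * q ^+ n.+1 = u * ('X - a%:P) ^+ n.+1 by rewrite -uv addrK.
exists (v * q ^+ n.+1); split.
- apply/eqP; rewrite eq_sym -subr_eq0; apply/eqP.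
  have := congr1 (horner^~ a) e1; rewrite [RHS]hornerM horner_exp hornerXsubC.
  by rewrite subrr expr0n mulr0 hornerD hornerN hornerC.
- by rewrite exprS mulrCA dvdp_mulr.
- rewrite e1 mulrACA dvdp_mull // mulrC exprMn.
  by apply: dvdp_mul; apply: dvdp_exp2l.
Qed.

(** Write $1=(1-e)+e$. As $e(1-e)$ kills [M], $y\otimes t^k(1-e)$ commutes with $w\otimes e$ on [M],
    while $y\otimes t^ke$ shifts eigenvalues by an integer when $y$ is an eigenvector of
    $\mathrm{ad}\,w$. *)
Lemma gen_eig_submodule (M : lieModule (loop g)) c e x (v : M) :
  kills (@setT M) (e * (1 - e)) ->
  gen_eig (act (loop_poly 0 w e)) (int_coset c) v ->
  gen_eig (act (loop_poly 0 w e)) (int_coset c) (act x v).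
Proof.
move=> ke; elim/loop_ind: x v => [v _|x y Hx Hy v Gv|k y v Gv].
- by rewrite act0l; apply: gen_eig0.
- by rewrite actDl; apply: gen_eigD; [exact: Hx|exact: Hy].
move: y; apply: w_grading.
  split=> [|a x y Gx Gy]; last first.
    by rewrite -loop_poly1 loop_poly_linearl !loop_poly1 act_linearl; apply: gen_eig_linear.
  by rewrite /loop_mono /mono monalgU0 act0l; apply: gen_eig0.
move=> m y wy; rewrite -loop_poly1 -[1](subrK e) linearD /= actDl.
apply: gen_eigD.
  apply: (gen_eig_stable (m := 0)) => [v'|r|//]; last by rewrite addr0.
  rewrite /= act_comm lie_loop_poly add0r (ke _ _ (e * (1 - e)) v') //.
  by rewrite scale0r.
apply: (gen_eig_stable (m := m%:~R)) => [v'|r|//]; last exact: int_coset_int.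
rewrite /= act_comm lie_loop_poly add0r wy; congr (_ + _).
have -> : loop_poly k (m%:~R *: y) (e * e) = m%:~R *: loop_poly k y (e * e).
  have := loop_poly_linearl k (e * e) m%:~R y 0; rewrite addr0 => ->.
  rewrite [X in _ + X]/loop_poly big1 ?addr0 // => i _.
  by rewrite /loop_mono /mono monalgU0 scaler0.
have -> : e * e = e - e * (1 - e) by rewrite mulrBr mulr1 opprB addrC subrK.
by rewrite actZl linearB /= -scaleN1r actDl actZl (ke _ _ (e * (1 - e)) v') // scaler0 addr0.
Qed.

Lemma Ext1_zero_spectral_type a c c' (U V : lieModule (loop g)) :
  spectral_type a w c (@setT U) -> spectral_type a w c' (@setT V) ->
  ~ is_int (c - c') -> Ext1_zero U V.
Proof.
move=> [q [n [qa kU gU]]] [q' [n' [qa' kV gV]]] ncc E i p ieq peq iinj psurj ker.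
pose Q := q * q'; pose P := (('X - a%:P) * Q) ^+ (n + n').
have {}kU : kills (@setT U) P.
  apply: kills_dvd kU; rewrite /P mulrA [X in _ %| X]exprMn dvdp_mulr //.
  by rewrite exprD dvdp_mulr.
have {}kV : kills (@setT V) P.
  apply: kills_dvd kV; rewrite /P /Q [q * _]mulrC mulrA [X in _ %| X]exprMn dvdp_mulr //.
  by rewrite exprD dvdp_mull.
have Qa : Q.[a] != 0 by rewrite hornerM mulf_neq0.
(* [P] annihilates both ends, so [P * P] annihilates [E]; hence the doubled exponent. *)
have [e [ea Qe Pe]] := approximate_idempotent ((n + n') * 2) Qa.
pose A : set E := fun x => exists v, i v = x.
have EAU : subquotient_iso A setT U.
  exists p; split=> // [b v v' _ _|u]; first exact: linearP.
  by have [x <-] := psurj u; exists x.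
have kA : kills A P by move=> k x f _ [v <-] Pf; rewrite -ieq kV // linear0.
have kE : kills (@setT E) (e * (1 - e)).
  apply: kills_dvd Pe _; rewrite exprM expr2.
  exact: (kills_extension g_simple _ EAU).
have {}gU u : gen_eig (act (loop_poly 0 w e)) (int_coset c) (u : U).
  by apply: gU => //; apply: dvdp_trans Qe; apply: dvdp_mulr.
have {}gV v : gen_eig (act (loop_poly 0 w e)) (int_coset c') (v : V).
  by apply: gV => //; apply: dvdp_trans Qe; apply: dvdp_mull.
set H := act (loop_poly 0 w e) in gU gV.
have disj r : int_coset c r -> int_coset c' r -> False.
  move=> rc rc'; apply: ncc; rewrite -[c - c'](subrKA r) addrC -opprB.
  by apply: is_intD => //; apply: is_intN.
pose G (x : E) := gen_eig (act (loop_poly 0 w e)) (int_coset c) x.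
have Glin b x y : G x -> G y -> G (b *: x + y) by apply: gen_eig_linear.
(* A preimage of [u] splits into parts for the two cosets; the part for [c'] maps to zero, as all
   eigenvalues on [U] lie in the coset of [c]. *)
have lift u : exists x, G x /\ p x = u.
  have [x <-] := psurj u; have [s sC sx] := gU (p x).
  have : p (shifts (act (loop_poly 0 w e)) s x) = 0.
    by rewrite (shifts_map (H' := act (loop_poly 0 w e))) // => y; rewrite peq.
  case/ker => v vE; have [s' sC' sv] := gV v.
  have /gen_eig_split : shifts (act (loop_poly 0 w e)) s
      (shifts (act (loop_poly 0 w e)) s' x) = 0.
    rewrite shiftsC -vE -(shifts_map (H := act (loop_poly 0 w e))) ?sv ?linear0 //.
  case/(_ _ _ disj sC sC') => x1 [x2 [-> Gx1 Gx2]].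
  exists x1; split=> //; rewrite linearD /= [X in _ + X](_ : _ = 0) ?addr0 //.
  apply: (gen_eig_disjoint disj (gU _)).
  by apply: gen_eig_map Gx2 => y; rewrite peq.
(* A difference with image zero comes from [V], so its eigenvalues lie in both cosets. *)
have inj x y : G x -> G y -> p x = p y -> x = y.
  move=> Gx Gy pxy; apply/subr0_eq.
  have [v vE] : exists v, i v = x - y by apply/ker; rewrite linearB /= pxy subrr.
  apply: (gen_eig_disjoint disj (H := act (loop_poly 0 w e))).
    by rewrite addrC -scaleN1r; apply: Glin.
  by rewrite -vE; apply: gen_eig_map (gV v) => v'; rewrite ieq.
have [s sP] := choice lift.
(* Uniqueness of lifts gives linearity here and equivariance below. *)
have slin : linear s.
  move=> b u u'; apply: inj; first exact: (sP _).1.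
    by apply: Glin; apply: (sP _).1.
  by rewrite linearP /= !(sP _).2.
pose sl : {linear U -> E} := HB.pack s (GRing.isLinear.Build _ _ _ _ _ slin).
exists sl; split=> [x u|u]; last exact: (sP _).2.
apply: inj; first exact: (sP _).1.
  by apply: gen_eig_submodule => //; apply: (sP _).1.
by rewrite /= peq !(sP _).2.
Qed.

End Splitting.

(** * Separating spectral characters by coweights *)

Section SpectralCharacter.
Context (K : closedFieldType) (g : fdLieAlgType K) (D : cartanDatum g).

Lemma chi_of_coeff (pi : drinfeld D) a :
  (chi_of pi)@_a = \pi_(Gamma D)%qT (weight_at a (factorization pi)).
Proof.
rewrite /chi_of /weight_at !raddf_sum [RHS]big_mkcond /=.
by apply: eq_bigr => y _; rewrite mcoeffU; case: eqP => _; rewrite ?mulr1n ?mulr0n.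
Qed.

Lemma Gamma_eq (x y : weight D) :
  (\pi_(Gamma D)%qT x == \pi_(Gamma D)%qT y) = root_lattice (x - y).
Proof.
pose I := GRing.ZmodClosed.clone (weight D) (@root_lattice K g D) _.
by rewrite -[root_lattice _]/(x - y \in I) Quotient.idealrBE.
Qed.

(** When the simple roots are integral on [w], the choice of representative matters only modulo
    $\mathbb Z$. *)
Definition class_val (w : subvs_of (csa D)) (gamma : Gamma D) : K :=
  dual_app (wt (repr gamma : weight D)) w.

(** Were the difference of representatives integral on all fundamental coweights, these integers
    would be its coordinates on the simple roots, placing it in $Q$. *)
Lemma Gamma_neq (x y : Gamma D) : x <> y ->
  exists w : subvs_of (csa D), (forall i, is_int (dual_app (sroot i) w)) /\
    ~ is_int (class_val w x - class_val w y).
Proof.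
move=> xy; have [w wE] := fundamental_coweights D.
have [H|/existsNP[i Hi]] := pselect (forall i,
    is_int (class_val (w i) x - class_val (w i) y)).
  have [c cE] := choice H; case: xy; rewrite -[x]reprK -[y]reprK.
  apply/eqP; rewrite Gamma_eq; apply/asboolP; exists c.
  rewrite (sroot_coords (wt _) wE); apply: eq_bigr => i _.
  by rewrite wtB -/(eval_at _ _) linearB /= /eval_at cE scaler_int.
exists (w i); split=> // j; rewrite wE; exists (j == i)%:R.
by rewrite rmorph_nat.
Qed.

Lemma class_int (w : subvs_of (csa D)) (x y : weight D) :
  (forall i, is_int (dual_app (sroot i) w)) ->
  \pi_(Gamma D)%qT x = \pi_(Gamma D)%qT y ->
  is_int (dual_app (wt x) w - dual_app (wt y) w).
Proof.
move=> w_int /eqP; rewrite Gamma_eq => /asboolP[c cE].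
rewrite -!/(eval_at w _) -linearB -wtB cE linear_sum /=.
elim/big_rec: _ => [|i z _ zi]; first by exists 0.
have [m mE] := w_int i; apply: is_intD => //.
by exists (m * c i); rewrite raddfMz /= /eval_at mE intrM mulrzr.
Qed.

Lemma spectral_type_int a (w : g) c c' (M : lieModule (loop g)) :
  is_int (c - c') -> spectral_type a w c (@setT M) -> spectral_type a w c' (@setT M).
Proof.
move=> cc [q [n [qa kM gM]]]; exists q, n; split=> // e ea qe v Bv.
apply: (gen_eig_sub _ (gM e ea qe v Bv)) => r; exact: int_coset_trans.
Qed.

Lemma Vpi_spectral_type_repr (w : subvs_of (csa D)) pi (N : lieModule (loop g)) a :
  (forall i, is_int (dual_app (sroot i) w)) -> is_Vpi pi N ->
  spectral_type (val a) (vsval w) (class_val w (chi_of pi)@_a)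
    (@setT N).
Proof.
move=> w_int Npi; apply: spectral_type_int (Vpi_spectral_type w_int a Npi).
by apply: class_int => //; rewrite reprK chi_of_coeff.
Qed.

Lemma Cchi_spectral_type (w : subvs_of (csa D)) chi (U : lieModule (loop g)) a :
  simple_lie g -> (forall i, is_int (dual_app (sroot i) w)) -> in_Cchi chi U ->
  spectral_type (val a) (vsval w) (class_val w chi@_a)
    (@setT U).
Proof.
move=> gs w_int [fdU Uchi]; apply: spectral_type_constituents => // N /Uchi[pi Npi ->].
exact: Vpi_spectral_type_repr.
Qed.

Lemma Xi_neq (chi chi' : Xi D) : chi <> chi' -> exists a, chi@_a <> chi'@_a.
Proof.
move=> nchi; apply: contrapT => H; apply: nchi; apply/malgP => a.
by apply: contrapT => Ha; apply: H; exists a.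
Qed.

(** The common core of both statements: pick a point where the characters differ, then a coweight
    separating their values there. *)
Lemma Ext1_zero_chi (chi chi' : Xi D) (U V : lieModule (loop g)) :
  simple_lie g -> chi <> chi' ->
  (forall (w : subvs_of (csa D)) a, (forall i, is_int (dual_app (sroot i) w)) ->
    spectral_type (val a) (vsval w) (class_val w chi@_a) (@setT U) /\
    spectral_type (val a) (vsval w) (class_val w chi'@_a) (@setT V)) ->
  Ext1_zero U V.
Proof.
move=> gs /Xi_neq[a /Gamma_neq[w [w_int nw]]] H; have [HU HV] := H w a w_int.
by apply: (Ext1_zero_spectral_type gs _ HU HV nw) => P; apply: grading_ind.
Qed.

End SpectralCharacter.

Theorem lemma5p2 (R : realType) (g : fdLieAlgType R[i])
    (g_simple : simple_lie g) (D : cartanDatum g) :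
  (forall (chi : Xi D) (U : lieModule (loop g)) (pi0 : drinfeld D)
      (V0 : lieModule (loop g)),
    in_Cchi chi U -> is_Vpi pi0 V0 -> chi <> chi_of pi0 ->
    Ext1_zero U V0) /\
  (forall (chi1 chi2 : Xi D) (V1 V2 : lieModule (loop g)),
    chi1 <> chi2 -> in_Cchi chi1 V1 -> in_Cchi chi2 V2 ->
    Ext1_zero V1 V2).
Proof.
split=> [chi U pi0 V0 Uchi V0pi nchi|chi1 chi2 V1 V2 nchi C1 C2].
  apply: (Ext1_zero_chi g_simple nchi) => w a w_int.
  (* The type of [U] comes from its constituents, that of [V0] directly from its tensor factors. *)
  by split; [apply: Cchi_spectral_type | apply: Vpi_spectral_type_repr].
apply: (Ext1_zero_chi g_simple nchi) => w a w_int.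
by split; apply: Cchi_spectral_type.
Qed.
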